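(* Let $(G_N)_{N\ge1}$ be a sequence of finite groups with $|G_N|\to\infty$. Assume that the sequence of measures $\widetilde{\mu}_{G_N}$ converges weakly to the Dirac mass at $\infty$. Let $m$ be a positive integer and, for each $N$, let $X^{N,1}=(X^{N,1}_g)_{g\in G_N},\ldots,X^{N,m}=(X^{N,m}_g)_{g\in G_N}$ be independent families of independent standard complex Gaussian variables. Then, as $N\to\infty$, the family of matrices $$\big(|G_N|^{-1/2}P_{X^{N,1}},\,|G_N|^{-1/2}P_{X^{N,1}}^\ast,\,\ldots,\,|G_N|^{-1/2}P_{X^{N,m}},\,|G_N|^{-1/2}P_{X^{N,m}}^\ast\big)$$ converges in moments to the family $(c_1,c_1^\ast,\ldots,c_m,c_m^\ast)$, where $c_1,\ldots,c_m$ are circular elements (of some $C^\ast$-probability space) such that $\{c_1,c_1^\ast\},\ldots,\{c_m,c_m^\ast\}$ are free.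
   Context: A standard complex Gaussian variable has independent real and imaginary parts, each real Gaussian with mean zero and variance $1/2$. For a finite group $G$ and $X\colon G\to\mathbb{C}$ (also written $X=(X_g)_{g\in G}$), $P_X\colon\mathbb{C}^G\to\mathbb{C}^G$ is the convolution operator $(P_Xv)(h)=\sum_{g\in G}X(hg^{-1})v(g)$, identified with the matrix $[X(hg^{-1})]_{h,g\in G}$; $P_X^\ast$ is its conjugate transpose. $\mathbb{Z}_+=\{1,2,\ldots\}$ and $\overline{\mathbb{Z}}_+=\mathbb{Z}_+\cup\{\infty\}$ is its one-point compactification. $\widehat{G}$ is the set of equivalence classes of irreducible unitary representations of $G$. $\widetilde{\mu}_G$ is the probability measure on $\overline{\mathbb{Z}}_+$ given by $\widetilde{\mu}_G(\{n\})=\frac{n^2}{|G|}|\{\Lambda\in\widehat G\colon\dim\Lambda=n\}|$ for $n\in\mathbb{Z}_+$ (the image under $\Lambda\mapsto\dim\Lambda$ of the Plancherel measure $\mu_G(\Lambda)=(\dim\Lambda)^2/|G|$). A $C^\ast$-probability space is a pair $(\mathcal{A},\varphi)$ with $\mathcal{A}$ a unital $C^\ast$-algebra and $\varphi$ a state on $\mathcal{A}$. A self-adjoint element $a\in\mathcal{A}$ is semicircular if $\varphi(a^n)=0$ for $n$ odd and $\varphi(a^{2k})=\frac{1}{k+1}\binom{2k}{k}$ for $k\in\mathbb{N}$. Unital subalgebras $\mathcal{A}_1,\ldots,\mathcal{A}_m$ are free if for every $n$, every sequence $i_1,\ldots,i_n\in\{1,\ldots,m\}$ with $i_k\ne i_{k+1}$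 for $k=1,\ldots,n-1$, and all $a_k\in\mathcal{A}_{i_k}$ with $\varphi(a_k)=0$, one has $\varphi(a_1\cdots a_n)=0$. A family of subsets of $\mathcal{A}$ is free if the unital subalgebras they generate are free. An element $c\in\mathcal{A}$ is circular if $c=(a+\sqrt{-1}\,b)/\sqrt2$ for two free semicircular elements $a,b$. Random $n\times n$ matrices are treated as elements of the noncommutative probability space $(\mathcal{M}_n,\frac1n\mathbb{E}\,\mathrm{tr})$, where $\mathcal{M}_n$ is the set of random variables with values in complex $n\times n$ matrices (here $n=|G_N|$). Tuples $A_N=(a_1^N,\ldots,a_r^N)$ in $(\mathcal{A}_N,\varphi_N)$ converge in moments to a tuple $A=(a_1,\ldots,a_r)$ in $(\mathcal{A},\varphi)$ if $\lim_{N\to\infty}\varphi_N(Q(A_N))=\varphi(Q(A))$ for every noncommutative polynomial $Q$ in $r$ variables. *)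

(* Defs.v *)
From HB Require Import structures.
From mathcomp Require Import all_boot all_order all_algebra all_fingroup.
From mathcomp Require Import all_field all_character finmap complex.
From mathcomp Require Import all_classical all_reals all_analysis.

Set Implicit Arguments.
Unset Strict Implicit.
Unset Printing Implicit Defensive.

Import Order.TTheory GRing.Theory Num.Theory.
Import numFieldNormedType.Exports.

Local Open Scope classical_set_scope.
Local Open Scope complex_scope.
Local Open Scope ring_scope.

(* HB has no join of the library's normed modules with its algebras, so the norm
   and its completeness are spelled out on top of an algType. *)
HB.mixin Record isCStarAlgebra (R : realType) (A : Type)
    & GRing.Algebra R[i] A := {
  adj : A -> A ;
  adjK : forall x : A, adj (adj x) = x ;
  adjD : forall x y : A, adj (x + y) = adj x + adj y ;
  adjZ : forall (k : R[i]) (x : A), adj (k *: x) = Num.conj k *: adj x ;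
  adjM : forall x y : A, adj (x * y) = adj y * adj x ;
  cnorm : A -> R ;
  cnorm0_eq0 : forall x : A, cnorm x = 0 -> x = 0 ;
  cnormD_le : forall x y : A, cnorm (x + y) <= cnorm x + cnorm y ;
  cnormZ : forall (k : R[i]) (x : A), cnorm (k *: x) = complex.Re `|k| * cnorm x ;
  cnormM_le : forall x y : A, cnorm (x * y) <= cnorm x * cnorm y ;
  cnorm_adjM : forall x : A, cnorm (adj x * x) = cnorm x ^+ 2 ;
  cnorm_complete : forall u : nat -> A,
    (forall e, 0 < e -> exists N, forall m n,
      (N <= m)%N -> (N <= n)%N -> cnorm (u m - u n) < e) ->
    exists x : A, cnorm (u n - x) @[n --> \oo] --> 0
}.

#[short(type="cstarAlgType")]
HB.structure Definition CStarAlgebra (R : realType) :=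
  {A of GRing.Algebra R[i] A & isCStarAlgebra R A}.

Section FreeProbability.
Variables (R : realType) (A : cstarAlgType R) (phi : {scalar A}).

Definition is_state := phi 1 = 1 /\ forall x : A, 0 <= phi (adj x * x).

Definition semicircular (x : A) :=
  [/\ adj x = x,
      forall n, odd n -> phi (x ^+ n) = 0
    & forall k, phi (x ^+ k.*2) = 'C(k.*2, k)%:R / k.+1%:R].

(* The purely algebraic span: no closure and no adjoints are added. *)
Definition gen_subalg (S : set A) : set A :=
  smallest (fun B => GRing.subalg_closed (mem B)) S.

(* Products of n.+1 factors; the empty product 1 has to be left out since
   phi 1 = 1. *)
Definition free_subalgs (I : Type) (B : I -> set A) :=
  forall (n : nat) (i : 'I_n.+1 -> I) (x : 'I_n.+1 -> A),
    (forall k l : 'I_n.+1, l = k.+1 :> nat -> i k <> i l) ->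
    (forall k, B (i k) (x k)) ->
    (forall k, phi (x k) = 0) ->
    phi (\prod_k x k) = 0.

Definition free_sets (I : Type) (S : I -> set A) :=
  free_subalgs (fun i => gen_subalg (S i)).

Definition circular (c : A) := exists a b : A,
  [/\ semicircular a, semicircular b,
      free_sets (fun t : bool => [set if t then b else a])
    & c = (sqrtC 2)^-1 *: (a + 'i%C *: b)].

End FreeProbability.

(* K<x_i, i in I>: finitely supported functions on the words in the letters I *)
Definition ncpoly (K : numClosedFieldType) (I : choiceType) :=
  {fsfun seq I -> K with 0}.

Definition nc_eval (K : numClosedFieldType) (I : choiceType) (A : algType K)
    (b : I -> A) (Q : ncpoly K I) : A :=
  \sum_(w <- finsupp Q) Q w *: \prod_(i <- w) b i.

(* Not an instance of nc_eval: an algType is nontrivial, 'M_0 is not. *)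
Definition nc_eval_mx (K : numClosedFieldType) (I : choiceType) (n : nat)
    (b : I -> 'M[K]_n) (Q : ncpoly K I) : 'M[K]_n :=
  \sum_(w <- finsupp Q) Q w *: \prod_(i <- w) b i.

Definition cvg_in_moments (K : numClosedFieldType) (I : choiceType)
    (mom_ : nat -> ncpoly K I -> K) (mom : ncpoly K I -> K) :=
  forall Q : ncpoly K I, mom_ N Q @[N --> \oo] --> (mom Q : K^o).

Section Independence.
Context {d : measure_display} {T : measurableType d} {R : realType}.
Variable P : probability T R.

Definition sigma_rv (I : Type) (X : I -> T -> R) : set (set T) :=
  <<s \bigcup_i preimage_set_system setT (X i) measurable >>.

Definition re_im (Z : T -> R[i]) (t : bool) : T -> R :=
  fun w => if t then complex.Im (Z w) else complex.Re (Z w).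

Definition sigma_crv (I : Type) (Z : I -> T -> R[i]) : set (set T) :=
  sigma_rv (fun p : I * bool => re_im (Z p.1) p.2).

Definition mutually_independent (I : finType) (F : I -> set (set T)) :=
  forall (J : {set I}) (E : I -> set T), (forall i, i \in J -> F i (E i)) ->
    P (\bigcap_(i in [set` J]) E i) = (\prod_(i in J) P (E i))%E.

(* normal_prob takes the standard deviation as its second parameter. *)
Definition std_complex_gaussian (Z : T -> R[i]) :=
  [/\ forall t, measurable_fun setT (re_im Z t),
      forall t (B : set R), measurable B ->
        P (re_im Z t @^-1` B) = normal_prob 0 (Num.sqrt 2^-1) B
    & mutually_independent (fun t : bool =>
        sigma_rv (fun _ : unit => re_im Z t))].

Definition cexpectation (Z : T -> R[i]) : R[i] :=
  Complex (fine ('E_P[re_im Z false])%E) (fine ('E_P[re_im Z true])%E).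

(* The state (1/n) E tr on the random matrices. *)
Definition exp_ntrace (n : nat) (M : T -> 'M[R[i]]_n) : R[i] :=
  n%:R^-1 * cexpectation (fun w => \tr (M w)).

End Independence.

Definition conv_mx (K : numClosedFieldType) (G : finGroupType) (X : G -> K) :
    'M[K]_#|G| :=
  \matrix_(h, g) X (enum_val h * (enum_val g)^-1)%g.

(* The pair |G|^(-1/2) P_X (t = false), |G|^(-1/2) P_X^* (t = true). *)
Definition scaled_conv_mx (K : numClosedFieldType) (G : finGroupType)
    (X : G -> K) (t : bool) : 'M[K]_#|G| :=
  (sqrtC #|G|%:R)^-1 *:
    (if t then map_mx Num.conj (conv_mx X)^T else conv_mx X).

Notation Zplus := (discrete_topology {n : nat | (0 < n)%N}).
Notation Zplus_bar := (one_point_compactification Zplus).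

Notation borel T := (g_sigma_algebraType (@open T)).

Definition cvg_weakly (R : realType) (T : ptopologicalType)
    (mu_ : nat -> {measure set (borel T) -> \bar R})
    (mu : {measure set (borel T) -> \bar R}) :=
  forall f : T -> R, continuous f -> (exists M, forall x, `|f x| <= M) ->
    \int[mu_ N]_(x in [set: borel T]) f x @[N --> \oo] -->
    \int[mu]_(x in [set: borel T]) f x.

(* The class of Lambda is represented by its character, an index in Iirr;
   irr_degree is the dimension of the representation 'Chi_i affording it. *)
Definition num_irr_dim (G : finGroupType) (n : nat) : nat :=
  #|[pred i : Iirr [set: G]%G | irr_degree (socle_of_Iirr i) == n]|.

Definition mu_weight (R : realType) (G : finGroupType) (n : nat) : {nonneg R} :=
  ((n%:R ^+ 2 / #|G|%:R) * (num_irr_dim G n)%:R)%:nng.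

Definition mu_tilde (R : realType) (G : finGroupType) :
    {measure set (borel Zplus_bar) -> \bar R} :=
  mseries (fun k => mscale (mu_weight R G k.+1)
    (dirac (Some (exist _ k.+1 (ltn0Sn k)) : borel Zplus_bar))) 0.

Definition dirac_infty (R : realType) :
    {measure set (borel Zplus_bar) -> \bar R} :=
  dirac (None : borel Zplus_bar).

(* Main.v *)
Require Import Defs.
From HB Require Import structures.
From mathcomp Require Import all_boot all_order all_algebra all_fingroup.
From mathcomp Require Import all_field all_character finmap complex.
From mathcomp Require Import all_classical all_reals all_analysis.
From mathcomp Require Import measurable_realfun ring lra zify.

(** The mixed moments on both sides are computed and compared.

    Random side. The matrix of the j-th family is the sum of X_g times the
    translation by g, so the normalized trace of a word in the matrices and
    their adjoints is a sum over labellings of the word by group elements with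
    trivial product. Wick's formula for complex Gaussian variables turns the
    expectation into a sum over the pairings of the word that match a letter
    with its adjoint, and a pairing contributes the probability that a random
    word in G, in which every letter occurs once as g and once as g^-1, is
    trivial ([exp_ntrace_word]). If the pairing is non-crossing the word
    cancels freely and the probability is 1. If two pairs cross, the word is
    conjugate to a x b y c x^-1 d y^-1; whatever the other letters, this is
    trivial for at most as many pairs (x, y) as there are commuting pairs
    ([card_crossing_fiber]), so the contribution is at most the probability
    that two random elements commute ([group_runs_stack_runs]). That
    probability is the number of conjugacy classes over |G|, that is the number
    of irreducible characters over |G|, which is the integral of 1/dim^2
    against the dimension measure; as 1/dim^2 is continuous on the
    compactification and vanishes at infinity, it tends to 0
    ([cvg_commuting_probability]). Hence the moment of a word tends to its
    number of non-crossing pairings.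

    Pairings are never handled as combinatorial objects: a word is read from
    the left while the letters that wait for a partner are kept in a sequence
    (the stack), and a pairing is a run of this process. A run is non-crossing
    exactly when it always matches the letter on top of the stack, which makes
    the induction on the word, and the comparison with Fock space, immediate.

    Limit side. On the Fock space with one basis vector per word in the letters
    (j, t), creation plus annihilation of a letter is a semicircular element,
    and these elements are free because an operator built from letters of one
    colour only acts on the longest prefix of that colour ([free_colored]).
    The combination (a + i b) / sqrt 2 of two of them pushes its own vector on a
    stack or removes its adjoint from the top, so its moments count the
    non-crossing pairings again ([circ_moment]).

    To stay with finite matrices, the Fock space is truncated to words of
    length at most D. The bounded families of operators on the truncated spaces
    form a C*-algebra ([bounded_family]), and the vacuum states of the
    truncations have a limit along an ultrafilter, which is a state
    ([vector_state]). A fixed polynomial in creation and annihilation operators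
    only sees words of bounded length, so truncation does not change its vacuum
    moment once D is large ([state_represents]). *)

Set Implicit Arguments.
Unset Strict Implicit.
Unset Printing Implicit Defensive.

Import Order.TTheory GRing.Theory Num.Theory.
Import numFieldNormedType.Exports.

(** * Pairings of a word, generated by reading it letter by letter *)

(** Listing each element together with what remains, rather than its position,
    lets removals commute with [map] and [cat]. *)
Fixpoint removals (T : Type) (s : seq T) : seq (T * seq T) :=
  if s is x :: s' then (x, s') :: [seq (p.1, x :: p.2) | p <- removals s']
  else [::].

Lemma removals_map (T U : Type) (f : T -> U) (s : seq T) :
  removals (map f s) = [seq (f p.1, map f p.2) | p <- removals s].
Proof. by elim: s => //= x s ->; rewrite -!map_comp. Qed.

Lemma removals_cat (T : Type) (s1 s2 : seq T) :
  removals (s1 ++ s2) = [seq (p.1, p.2 ++ s2) | p <- removals s1]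
                     ++ [seq (p.1, s1 ++ p.2) | p <- removals s2].
Proof.
elim: s1 => [|x s1 IH] /=; first by rewrite -[LHS]map_id; apply: eq_map => -[].
by rewrite IH map_cat -!map_comp.
Qed.

Section Runs.
Variables (L : eqType) (bar : L -> L).

(** The pairings of [w] with the waiting letters [s] that match [l] with [bar l]
    and no two letters of [s]: a letter read either waits in its turn or is
    matched with a waiting one. For [s] empty this is the sum over all pairings
    of Wick's formula. *)
Fixpoint runs (w s : seq L) : nat :=
  if w is l :: w' then
    runs w' (l :: s) + \sum_(p <- removals s | p.1 == bar l) runs w' p.2
  else s == [::].

(** Only the letter that has waited least may be matched: these are the
    non-crossing pairings. *)
Fixpoint stack_runs (w s : seq L) : nat :=
  if w is l :: w' then
    stack_runs w' (l :: s) +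
    (if s is y :: s' then if y == bar l then stack_runs w' s' else 0 else 0)
  else s == [::].

End Runs.
Arguments runs {L} bar w s.
Arguments stack_runs {L} bar w s.

Lemma removals_perm (T : eqType) (s : seq T) (p : T * seq T) :
  p \in removals s -> perm_eq s (p.1 :: p.2).
Proof.
elim: s p => [//|x s IH] p /=; rewrite inE => /orP[/eqP -> //|/mapP[q qs ->]] /=.
have := IH q qs; rewrite -(perm_cons x) => /perm_trans; apply.
by apply/seq.permP => a /=; rewrite addnCA.
Qed.

Lemma count_removals (T : eqType) (a : pred T) (s : seq T) :
  \sum_(p <- removals s | a p.1) 1 = count a s.
Proof.
elim: s => [|x s IH] /=; first by rewrite big_nil.
by rewrite big_cons big_map /= IH; case: (a x).
Qed.

Lemma runs_map (L L' : eqType) (bar : L -> L) (bar' : L' -> L') (f : L -> L') :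
  injective f -> (forall x, bar' (f x) = f (bar x)) ->
  forall w s, runs bar' (map f w) (map f s) = runs bar w s.
Proof.
move=> fI fbar; elim=> [|l w IH] s /=; first by case: s.
rewrite -(IH (l :: s)) removals_map big_map fbar; congr (_ + _).
by apply: eq_big => [p|p _]; rewrite ?(inj_eq fI) ?IH.
Qed.

Section PairingCount.
Variable I : finType.
Implicit Types w s : seq (I * bool).

Definition flip (x : I * bool) := (x.1, ~~ x.2).

(** Pairings at a single index, when [a] plain and [b] mirrored letters remain to
    be read while [p] plain and [q] mirrored ones wait. The waiting letters are
    matched in b!/(b-p)! times a!/(a-q)! ways, and the b-p = a-q letters left on
    each side in (a-q)! ways. *)
Definition local_runs a b p q :=
  if (b + q == a + p) && (p <= b) then b`! * a ^_ q else 0.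

Lemma local_runs00 a b : local_runs a b 0 0 = if a == b then a`! else 0.
Proof. by rewrite /local_runs !addn0 ffactn0 muln1 eq_sym andbT; case: eqP => // ->. Qed.

Lemma local_runs_push_false a b p q :
  local_runs a.+1 b p q = local_runs a b p.+1 q + q * local_runs a b p q.-1.
Proof.
rewrite /local_runs; case: q => [|q] /=.
  have -> : (b + 0 == a.+1 + p) && (p <= b) = (b + 0 == a + p.+1) && (p < b) by lia.
  by rewrite mul0n !addn0 !ffactn0.
have -> : (b + q.+1 == a.+1 + p) = (b + q == a + p) by lia.
have -> : (b + q.+1 == a + p.+1) = (b + q == a + p) by lia.
case: eqP => //= e; last by rewrite muln0.
rewrite ffactSS ffactnSr; case: (ltngtP p b) => pb.
- have -> : a.+1 = (a - q) + q.+1 by lia.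
  by rewrite mulnDl mulnDr [_ * (a - q)]mulnC; congr (_ + _); rewrite mulnCA.
- by rewrite muln0.
- have -> : a = q by lia.
  by rewrite add0n mulnCA.
Qed.

Lemma local_runs_push_true a b p q :
  local_runs a b.+1 p q = local_runs a b p q.+1 + p * local_runs a b p.-1 q.
Proof.
rewrite /local_runs.
have -> : (b.+1 + q == a + p) = (b + q.+1 == a + p) by lia.
case: p => [|p] /=.
  rewrite mul0n !addn0 !andbT; case: eqP => //= e.
  rewrite factS ffactnSr; have -> : b.+1 = a - q by lia.
  by rewrite [RHS]mulnA [RHS]mulnC mulnA.
have -> : (b + q == a + p) = (b + q.+1 == a + p.+1) by lia.
case: eqP => //= e; last by rewrite muln0.
rewrite factS ffactnSr; case: (ltngtP p b) => [pb|pb|pb].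
- rewrite ltnS (ltnW pb).
  have -> : b.+1 = (a - q) + p.+1 by lia.
  by rewrite -mulnA mulnDl; congr (_ + _); rewrite [RHS]mulnA [RHS]mulnC.
- have -> : (p.+1 <= b.+1) = false by lia.
  by rewrite muln0.
- by rewrite pb leqnn -mulnA.
Qed.

Definition occ t i (w : seq (I * bool)) := count_mem (i, t) w.
Local Arguments occ : simpl never.

Definition pairing_count w s :=
  \prod_i local_runs (occ false i w) (occ true i w) (occ false i s) (occ true i s).

(** Letters of different indices never interact, so the recursion of [runs] is
    that of [local_runs] at the index of the letter read. *)
Lemma runs_pairing_count w s : runs flip w s = pairing_count w s.
Proof.
elim: w s => [|[i t] w IH] s /=.
  rewrite /pairing_count /=; case: s => [|[i t] s] /=.
    by rewrite big1 // => i _; rewrite local_runs00.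
  rewrite (bigD1 i) //= (_ : local_runs 0 0 _ _ = 0) ?mul0n //.
  by rewrite /occ /local_runs /= ifF // !xpair_eqE !eqxx /=; case: t => /=; lia.
rewrite IH.
have occ_cons t' j x u : occ t' j (x :: u) = (x == (j, t')) + occ t' j u by [].
have -> : \sum_(p <- removals s | p.1 == flip (i, t)) runs flip w p.2 =
  occ (~~ t) i s * (local_runs (occ false i w) (occ true i w)
     (occ false i s - (t : nat)) (occ true i s - (~~ t : nat)) *
   \prod_(j | j != i) local_runs (occ false j w) (occ true j w) (occ false j s) (occ true j s)).
  rewrite /occ -(count_removals (pred1 (i, ~~ t))) big_distrl /=.
  rewrite [LHS]big_seq_cond [RHS]big_seq_cond; apply: eq_bigr => p /andP[ps /eqP e].
  rewrite mul1n IH /pairing_count (bigD1 i) //=.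
  have hp a : count a s = a p.1 + count a p.2 by have /seq.permP -> := removals_perm ps.
  rewrite /occ !hp e /flip /= !xpair_eqE !eqxx /=.
  congr (_ * _); first by congr (local_runs _ _ _ _); case: (t) => /=; lia.
  apply: eq_bigr => j ji; by rewrite !hp e /flip /= !xpair_eqE !(eq_sym i) !(negPf ji).
rewrite /pairing_count (bigD1 i) //= [RHS](bigD1 i) //= !occ_cons !xpair_eqE !eqxx /=.
have -> : \prod_(j | j != i) local_runs (occ false j w) (occ true j w)
     (occ false j ((i, t) :: s)) (occ true j ((i, t) :: s)) =
   \prod_(j | j != i) local_runs (occ false j w) (occ true j w) (occ false j s) (occ true j s).
  by apply: eq_bigr => j ji; rewrite !occ_cons !xpair_eqE !(eq_sym i) !(negPf ji).
have -> : \prod_(j | j != i) local_runs (occ false j ((i, t) :: w)) (occ true j ((i, t) :: w))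
     (occ false j s) (occ true j s) =
   \prod_(j | j != i) local_runs (occ false j w) (occ true j w) (occ false j s) (occ true j s).
  by apply: eq_bigr => j ji; rewrite !occ_cons !xpair_eqE !(eq_sym i) !(negPf ji).
rewrite mulnA -mulnDl; congr (_ * _).
case: t; rewrite /= !(add0n, add1n, subn0, subn1).
  by rewrite local_runs_push_true.
by rewrite local_runs_push_false.
Qed.

Lemma runs_from_empty w : runs flip w [::] =
  \prod_i (if occ false i w == occ true i w then (occ false i w)`! else 0).
Proof.
rewrite runs_pairing_count; apply: eq_bigr => i _; exact: local_runs00.
Qed.

End PairingCount.

(** * Ballot numbers *)

(** Walks on the natural numbers with steps 1 and -1, from h to 0 in k steps. *)
Fixpoint ballot k h : nat :=
  if k is k'.+1 then
    (ballot k' h.+1 + (if h is h'.+1 then ballot k' h' else 0))%N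
  else (h == 0)%N.

Lemma ballot_odd k h : odd k != odd h -> ballot k h = 0%N.
Proof.
elim: k h => [|k IH] [|h] //= hk; rewrite ?IH ?addn0 //=.
all: by move: hk => /=; case: (odd k) => //; case: (odd h).
Qed.

Lemma ballot_gt k h : (k < h)%N -> ballot k h = 0%N.
Proof.
elim: k h => [|k IH] [|h] //= hk; rewrite !IH //; lia.
Qed.

(** The binomial coefficient of k and j - 1, with the value 0 at j = 0 that
    truncated subtraction would miss. *)
Definition bin_pred k j : nat := if j is j'.+1 then 'C(k, j') else 0%N.

Lemma binS_pred k j : 'C(k.+1, j) = ('C(k, j) + bin_pred k j)%N.
Proof. by case: j => [|j]; rewrite ?bin0 // binS. Qed.

(** The reflection principle, stated without subtraction; j is the number of
    steps up. *)
Lemma ballot_bin h j : (ballot (h + j.*2) h + bin_pred (h + j.*2) j)%N = 'C(h + j.*2, j).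
Proof.
move: {2}(h + j.*2)%N (erefl (h + j.*2)%N) => k hk; elim: k h j hk => [|k IH] h j hk.
  have -> : h = 0%N by lia.
  by have -> : j = 0%N by lia.
rewrite hk /= binS_pred.
have up : (ballot k h.+1 + bin_pred k j.-1 = bin_pred k j)%N.
  case: j hk => [|j] hk /=; first by rewrite ballot_gt //; lia.
  by have e : (h.+1 + j.*2)%N = k by [lia]; have := IH h.+1 j e; rewrite e.
have bp : bin_pred k.+1 j = (bin_pred k j + bin_pred k j.-1)%N.
  by case: j {hk up} => [|j] //=; rewrite binS_pred.
case: h hk up => [|h] hk up.
  rewrite addn0 bp.
  have <- : bin_pred k j = 'C(k, j).
    case: j hk {up bp} => [|j] hk; first by [].
    have -> : k = (j.+1 + j)%N by lia.
    by rewrite /= -[RHS]bin_sub ?leq_addr // addKn.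
  by rewrite -up; lia.
have e : (h + j.*2)%N = k by lia.
by have := IH h j e; rewrite e bp; lia.
Qed.

Lemma ballot_catalan k : (ballot k.*2 0 * k.+1)%N = 'C(k.*2, k).
Proof.
have := ballot_bin 0 k; rewrite add0n; case: k => [|k] //= h.
have := mul_bin_left k.+1.*2 k.
have -> : (k.+1.*2 - k = k.+2)%N by lia.
move: h; rewrite /bin_pred; nia.
Qed.

Local Open Scope ring_scope.

(** * Labelled pairings over a finite group *)

Lemma sum_removals_cat_cons (V : nmodType) (T : Type) (P : pred T)
    (F : T -> seq T -> V) (s1 s2 : seq T) (x : T) :
  \sum_(p <- removals (s1 ++ x :: s2) | P p.1) F p.1 p.2 =
  \sum_(p <- removals s1 | P p.1) F p.1 (p.2 ++ x :: s2)
  + ((if P x then F x (s1 ++ s2) else 0)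
     + \sum_(p <- removals s2 | P p.1) F p.1 (s1 ++ x :: p.2)).
Proof.
rewrite removals_cat big_cat big_map /= big_cons /= -map_comp big_map /=.
by case: ifP => // _; rewrite add0r.
Qed.

Section CommutingPairs.
Variable G : finGroupType.

Definition commuting_pairs : {set G * G} := [set p | (p.1 * p.2 == p.2 * p.1)%g].

Lemma card_commuting_pairs : #|commuting_pairs| = \sum_(z : G) #|'C[z]%g|.
Proof.
rewrite -sum1_card (eq_bigl (fun p : G * G => true && (p.1 \in 'C[p.2]%g))); last first.
  by move=> [x y]; rewrite inE /= cent1C; apply/eqP/cent1P.
rewrite -(pair_big_dep xpredT (fun x y => x \in 'C[y]%g) (fun _ _ => 1%N)) /=.
rewrite (exchange_big_dep xpredT) //=; apply: eq_bigr => z _.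
by rewrite sum1dep_card; apply: eq_card => x; rewrite !inE.
Qed.

(** Two solutions differ by an element of the centralizer of [z]. *)
Lemma card_conj_solutions (z t : G) :
  (#|[set x : G | (x * z * x^-1 == t)%g]| <= #|'C[z]%g|)%N.
Proof.
have [->|[x0]] := set_0Vmem [set x : G | (x * z * x^-1 == t)%g]; first by rewrite cards0.
rewrite inE => /eqP h0.
rewrite -(card_imset _ (mulgI x0^-1%g)); apply/subset_leq_card/fintype.subsetP => y /imsetP[x].
rewrite inE -h0 => /eqP hx ->; apply/cent1P; rewrite /commute.
have e : (x * z = x0 * z * x0^-1 * x)%g by apply: (mulIg x^-1%g); rewrite hx mulgK.
by rewrite -mulgA e !mulgA mulVg mul1g.
Qed.

(** For a fixed y the equation prescribes the conjugate of b y by x, so it has at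
    most as many solutions x as b y has commuting elements; b y runs over the
    whole group with y. *)
Lemma card_crossing_fiber (a b B h : G) :
  (#|[set p : G * G | (a * p.1 * b * p.2 * p.1^-1 * B * p.2^-1 == h)%g]|
     <= #|commuting_pairs|)%N.
Proof.
rewrite card_commuting_pairs -sum1_card.
rewrite (eq_bigl (fun p : G * G => true &&
   (p.1 * (b * p.2) * p.1^-1 == a^-1 * h * p.2 * B^-1)%g)); last first.
  move=> [x y]; rewrite inE /=.
  apply/eqP/eqP => [<-|e]; first by rewrite !mulgA mulVg mul1g mulgKV mulgK.
  have -> : (a * x * b * y * x^-1 = a * (x * (b * y) * x^-1))%g by rewrite !mulgA.
  by rewrite e !mulgA mulgV mul1g mulgKV mulgK.
rewrite -(pair_big_dep xpredT (fun x y => (x * (b * y) * x^-1 == a^-1 * h * y * B^-1)%g)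
  (fun _ _ => 1%N)) /=.
rewrite (exchange_big_dep xpredT) //= (reindex_inj (mulgI b^-1%g)) /=.
apply: leq_sum => z _; rewrite sum1dep_card.
apply: leq_trans (card_conj_solutions z (a^-1 * h * (b^-1 * z) * B^-1)%g).
by apply: subset_leq_card; apply/fintype.subsetP => x; rewrite !inE mulKVg.
Qed.

End CommutingPairs.

Section GroupRuns.
Variables (L : eqType) (bar : L -> L) (G : finGroupType) (K : numFieldType).
Local Notation n := (#|G|%:R : K).

(** Runs whose letters carry elements of [G]: a letter that waits receives a
    uniform label u, its partner the label u^-1, [h] is the product of the labels
    read so far, and only the runs of trivial product count. From an empty stack
    this sums, over the pairings of [w], the probability that the labelled word
    is trivial. *)
Fixpoint group_runs (w : seq L) (s : seq (L * G)) (h : G) : K :=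
  if w is l :: w' then
    n^-1 * (\sum_u group_runs w' ((l, u) :: s) (h * u)%g) +
    \sum_(p <- removals s | p.1.1 == bar l) group_runs w' p.2 (h * p.1.2^-1)%g
  else ((s == [::]) && (h == 1%g))%:R.

Lemma cardG_neq0 : n != 0.
Proof. by rewrite pnatr_eq0 -lt0n; apply/card_gt0P; exists 1%g. Qed.

Lemma avgG_const (x : K) : n^-1 * (\sum_(u : G) x) = x.
Proof. 
have -> : \sum_(u : G) x = n * x by rewrite sumr_const mulr_natl.
by rewrite mulKf ?cardG_neq0. Qed.

Lemma group_runs_ge0 w s h : 0 <= group_runs w s h.
Proof.
elim: w s h => [|l w IH] s h /=; first exact: ler0n.
by rewrite addr_ge0 ?mulr_ge0 ?invr_ge0 ?ler0n ?sumr_ge0.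
Qed.

(** Summing over the initial product drops the condition that the final one is
    trivial, since right translations permute the group. *)
Lemma sum_group_runs w s :
  \sum_h group_runs w s h = (runs bar w (map fst s))%:R.
Proof.
elim: w s => [|l w IH] s /=.
  rewrite (bigD1 1%g) //= eqxx andbT big1 ?addr0 => [|h /negPf->]; last by rewrite andbF.
  by case: s.
rewrite big_split /= -big_distrr exchange_big /= natrD; congr (_ + _).
  rewrite -[RHS]avgG_const; congr (_ * _); apply: eq_bigr => u _.
  by rewrite -(IH ((l, u) :: s)) [RHS](reindex_inj (mulIg u)).
rewrite exchange_big /= removals_map big_map natr_sum; apply: eq_bigr => p _.
by rewrite -IH [RHS](reindex_inj (mulIg (p.1.2)^-1%g)).
Qed.

Local Notation c := (#|commuting_pairs G|%:R : K).

(** The factor a x b y x^-1 B is the product just after x has been matched across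
    the still waiting y. Until y is matched, reading only changes [B]; when it is
    matched, the pattern of [card_crossing_fiber] is complete. *)
Lemma sum_crossing (s1 s2 : seq (L * G)) (z : L) w (a b B : G) :
  \sum_x \sum_y group_runs w (s1 ++ (z, y) :: s2) (a * x * b * y * x^-1 * B)%g
    <= c * (runs bar w (map fst s1 ++ z :: map fst s2))%:R.
Proof.
elim: w s1 s2 a b B => [|l w IH] s1 s2 a b B.
  rewrite /= (_ : map fst s1 ++ _ == _ = false); last by case: (s1).
  rewrite mulr0 big1 // => x _; rewrite big1 // => y _.
  by rewrite (_ : _ ++ _ == _ = false) //; case: (s1).
rewrite /= natrD mulrDr.
under eq_bigr do rewrite big_split /=.
rewrite big_split /=; apply: lerD.
  under eq_bigr do rewrite -big_distrr exchange_big /=.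
  rewrite -big_distrr exchange_big /= -[leRHS]avgG_const.
  apply: ler_wpM2l; first by rewrite invr_ge0 ler0n.
  apply: ler_sum => u _; apply: le_trans (IH ((l, u) :: s1) s2 a b (B * u)%g).
  by under [leRHS]eq_bigr do under eq_bigr do rewrite !mulgA.
under eq_bigr do under eq_bigr do rewrite (sum_removals_cat_cons
  (fun q => q.1 == bar l) (fun q t => group_runs w t (_ * q.2^-1)%g)).
rewrite (sum_removals_cat_cons (fun q => q == bar l) (fun _ t => runs bar w t)) /=.
rewrite !natrD !mulrDr.
under eq_bigr do rewrite !big_split /=.
rewrite !big_split /=; apply: lerD; last apply: lerD.
- under eq_bigr do rewrite exchange_big /=.
  rewrite exchange_big /= removals_map big_map natr_sum mulr_sumr.
  apply: ler_sum => p _.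
  apply: le_trans (IH p.2 s2 a b (B * p.1.2^-1)%g).
  by under [leRHS]eq_bigr do under eq_bigr do rewrite !mulgA.
- case: ifP => _; last by rewrite mulr0 big1 // => x _; rewrite big1.
  rewrite -map_cat -sum_group_runs mulr_sumr pair_big /=.
  rewrite (partition_big (fun p => (a * p.1 * b * p.2 * p.1^-1 * B * p.2^-1)%g) xpredT) //=.
  apply: ler_sum => h _.
  rewrite (eq_bigr (fun=> group_runs w (s1 ++ s2) h)); last by move=> p /eqP ->.
  rewrite sumr_const -[leLHS]mulr_natl; apply: ler_wpM2r; first exact: group_runs_ge0.
  rewrite ler_nat; apply: leq_trans (card_crossing_fiber a b B h).
  by apply: subset_leq_card; apply/fintype.subsetP => p; rewrite !inE.
- under eq_bigr do rewrite exchange_big /=.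
  rewrite exchange_big /= removals_map big_map natr_sum mulr_sumr.
  apply: ler_sum => p _.
  apply: le_trans (IH s1 p.2 a b (B * p.1.2^-1)%g).
  by under [leRHS]eq_bigr do under eq_bigr do rewrite !mulgA.
Qed.

Fixpoint avg (s : seq L) (F : seq (L * G) -> K) : K :=
  if s is l :: s' then n^-1 * (\sum_u avg s' (fun t => F ((l, u) :: t)))
  else F [::].

Lemma ler_avg s F F' : (forall t, map fst t = s -> F t <= F' t) -> avg s F <= avg s F'.
Proof.
elim: s F F' => [|l s IH] F F' h /=; first exact: h.
apply: ler_wpM2l; first by rewrite invr_ge0 ler0n.
by apply: ler_sum => u _; apply: IH => t ht; apply: h; rewrite /= ht.
Qed.

Lemma eq_avg s F F' : (forall t, map fst t = s -> F t = F' t) -> avg s F = avg s F'.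
Proof. by move=> h; apply/le_anti/andP; split; apply: ler_avg => t /h ->. Qed.

Lemma avg_const s x : avg s (fun=> x) = x.
Proof.
elim: s => //= l s IH; rewrite -[RHS]avgG_const; congr (_ * _).
by apply: eq_bigr => u _; rewrite IH.
Qed.

Lemma avgD s F F' : avg s (fun t => F t + F' t) = avg s F + avg s F'.
Proof.
elim: s F F' => //= l s IH F F'; rewrite -mulrDr -big_split; congr (_ * _).
by apply: eq_bigr => u _; rewrite IH.
Qed.

Lemma avgZ s a F : avg s (fun t => a * F t) = a * avg s F.
Proof.
elim: s F => //= l s IH F; rewrite mulrCA [in RHS]mulr_sumr; congr (_ * _).
by apply: eq_bigr => u _; rewrite IH.
Qed.

Lemma avg_sum s (I : Type) (r : seq I) (P : pred I) F :
  avg s (fun t => \sum_(i <- r | P i) F i t) = \sum_(i <- r | P i) avg s (F i).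
Proof.
elim: r => [|i r IH]; first by rewrite (eq_avg (F' := fun=> 0)) ?avg_const ?big_nil // => t _; rewrite big_nil.
rewrite big_cons -IH; case: ifP => hi; rewrite -?avgD; apply: eq_avg => t _; by rewrite big_cons hi.
Qed.

(** The product read so far, when every match was with the top of the stack: the
    labels in between have cancelled. *)
Fixpoint stack_prod (s : seq (L * G)) : G :=
  if s is x :: s' then (stack_prod s' * x.2)%g else 1%g.

(** The removed label x is a factor of [stack_prod], of the form a x b with a and
    b independent of x, so it can be averaged first. *)
Lemma avg_removals (e : L) (M : seq L -> K) (s : seq L)
    (Phi : G -> seq (L * G) -> G -> K) :
  (forall t a b, map fst t \in [seq p.2 | p <- removals s & p.1 == e] ->
     n^-1 * (\sum_x Phi x t (a * x * b)%g) <= M (map fst t)) ->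
  avg s (fun t => \sum_(p <- removals t | p.1.1 == e) Phi p.1.2 p.2 (stack_prod t))
    <= \sum_(p <- removals s | p.1 == e) M p.2.
Proof.
elim: s M Phi => [|l s IH] M Phi H /=; first by rewrite !big_nil.
rewrite big_cons big_map /=.
have {}IH u : avg s (fun t => \sum_(p <- removals t | p.1.1 == e)
    Phi p.1.2 ((l, u) :: p.2) (stack_prod t * u)%g)
   <= \sum_(p <- removals s | p.1 == e) M (l :: p.2).
  apply: (IH (fun t => M (l :: t)) (fun x t h => Phi x ((l, u) :: t) (h * u)%g)).
  move=> t a b ht /=.
  under eq_bigr do rewrite -mulgA.
  apply: (H ((l, u) :: t)) => /=.
  move/mapP: ht => [p]; rewrite mem_filter => /andP[hp1 hp2] ->.
  have hin : (p.1, l :: p.2) \in [seq (p0.1, l :: p0.2) | p0 <- removals s].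
    by apply/mapP; exists p.
  case: ifP => _; rewrite ?inE; last first.
    by apply/mapP; exists (p.1, l :: p.2) => //; rewrite mem_filter hp1.
  apply/orP; right; apply/mapP; exists (p.1, l :: p.2) => //; rewrite mem_filter hp1 //.
under eq_bigr do under eq_avg do rewrite big_cons big_map /=.
have -> : (if l == e then M s + \sum_(p <- removals s | p.1 == e) M (l :: p.2)
           else \sum_(p <- removals s | p.1 == e) M (l :: p.2))
   = (if l == e then M s else 0) + \sum_(p <- removals s | p.1 == e) M (l :: p.2).
  by case: ifP => // _; rewrite add0r.
pose A t u := if l == e then Phi u t (stack_prod t * u)%g else 0.
pose B u t := \sum_(p <- removals t | p.1.1 == e)
    Phi p.1.2 ((l, u) :: p.2) (stack_prod t * u)%g.
rewrite (eq_bigr (fun u => avg s (A^~ u) + avg s (B u))); last first.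
  move=> u _; rewrite -avgD; apply: eq_avg => t _; rewrite /A /B.
  by case: ifP => // _; rewrite add0r.
rewrite big_split mulrDr; apply: lerD; last first.
  rewrite -[leRHS]avgG_const; apply: ler_wpM2l; first by rewrite invr_ge0 ler0n.
  by apply: ler_sum => u _; exact: IH.
rewrite -avg_sum -avgZ -[leRHS](avg_const s); apply: ler_avg => t ht.
rewrite /A; case: ifP => hl; last by rewrite big1 ?mulr0.
rewrite -ht; under eq_bigr do rewrite -[(_ * _)%g]mulg1.
by apply: H; rewrite /= hl /= inE ht eqxx.
Qed.

(** Along a run that only matches the top, the product stays equal to
    [stack_prod], hence ends trivial whatever the labels. *)
Lemma stack_runs_le w t :
  (stack_runs bar w (map fst t))%:R <= group_runs w t (stack_prod t).
Proof.
elim: w t => [|l w IH] t /=; first by case: t => [|x t] //=; rewrite eqxx.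
rewrite natrD; apply: lerD.
  rewrite -[leLHS]avgG_const; apply: ler_wpM2l; first by rewrite invr_ge0 ler0n.
  by apply: ler_sum => u _; exact: (IH ((l, u) :: t)).
case: t => [|x t] /=; first by rewrite big_nil.
rewrite big_cons; case: ifP => _; last by rewrite sumr_ge0 // => *; apply: group_runs_ge0.
by rewrite -[leLHS]addr0 mulgK lerD ?IH // sumr_ge0 // => *; apply: group_runs_ge0.
Qed.

(** The difference comes from the runs that match below the top. At the first
    such match the product is still [stack_prod] and the top letter is matched
    later, across the match just made, so [sum_crossing] applies. *)
Lemma avg_group_runs w s :
  avg s (fun t => group_runs w t (stack_prod t) - (stack_runs bar w s)%:R)
    <= c / n ^+ 2 * (runs bar w s)%:R.
Proof.
have n0 := cardG_neq0.
elim: w s => [|l w IH] s.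
  rewrite -[leRHS]addr0 -[avg _ _]addr0; apply: lerD => //.
  rewrite (@eq_avg _ _ (fun=> 0)) ?avg_const ?mulr_ge0 ?invr_ge0 ?exprn_ge0 ?ler0n //.
  by case: s => [|x s] [|y t] //=; rewrite ?eqxx ?subrr.
pose D t := \sum_(p <- removals t | p.1.1 == bar l)
     group_runs w p.2 (stack_prod t * p.1.2^-1)%g
   - (if s is y :: s' then if y == bar l then (stack_runs bar w s')%:R else 0 else 0).
rewrite (@eq_avg _ _ (fun t => n^-1 * (\sum_u (group_runs w ((l, u) :: t)
   (stack_prod ((l, u) :: t)) - (stack_runs bar w (l :: s))%:R)) + D t)); last first.
  move=> t ht /=; rewrite big_split /= mulrDr avgG_const natrD opprD /D.
  rewrite addrACA; congr (_ + _ + (_ - _)).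
  by case: (s) => // y s'; case: ifP.
rewrite avgD /= natrD mulrDr; apply: lerD.
  by rewrite avgZ avg_sum; exact: (IH (l :: s)).
rewrite /D {D}; case: s => [|y s].
  by rewrite /= !big_nil subr0 mulr_ge0 ?mulr_ge0 ?invr_ge0 ?exprn_ge0 ?ler0n.
rewrite [X in _ <= _ * X%:R]/= big_cons big_map /=.
pose A t := if y == bar l then group_runs w t (stack_prod t) - (stack_runs bar w s)%:R else 0.
pose B v t := \sum_(p <- removals t | p.1.1 == bar l)
  group_runs w ((y, v) :: p.2) (stack_prod t * v * p.1.2^-1)%g.
rewrite (eq_bigr (fun v => avg s A + avg s (B v))); last first.
  move=> v _; rewrite -avgD; apply: eq_avg => t _; rewrite /A /B big_cons big_map /=.
  by case: ifP => _; rewrite ?subr0 ?add0r // mulgK addrAC.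
rewrite big_split mulrDr avgG_const.
have -> : (if y == bar l then (runs bar w s + \sum_(p <- removals s | p.1 == bar l) runs bar w (y :: p.2))%N
           else \sum_(p <- removals s | p.1 == bar l) runs bar w (y :: p.2))
   = ((if y == bar l then runs bar w s else 0)
     + \sum_(p <- removals s | p.1 == bar l) runs bar w (y :: p.2))%N.
  by case: ifP.
rewrite natrD mulrDr; apply: lerD.
  by rewrite /A; case: ifP => // _; rewrite avg_const mulr0.
rewrite -avg_sum -avgZ natr_sum mulr_sumr.
rewrite (@eq_avg _ _ (fun t => \sum_(p <- removals t | p.1.1 == bar l)
   n^-1 * (\sum_v group_runs w ((y, v) :: p.2) (stack_prod t * v * p.1.2^-1)%g))); last first.
  by move=> t _; rewrite /B exchange_big /= mulr_sumr.
apply: (avg_removals (M := fun t => c / n ^+ 2 * (runs bar w (y :: t))%:R)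
  (Phi := fun x t h => n^-1 * (\sum_v group_runs w ((y, v) :: t) (h * v * x^-1)%g))).
move=> t a b _.
rewrite -mulr_sumr mulrA -expr2 exprVn mulrAC [leRHS]mulrC.
apply: ler_wpM2l; first by rewrite invr_ge0 exprn_ge0 // ler0n.
apply: le_trans (sum_crossing [::] t y w a b 1%g).
by under [leRHS]eq_bigr do under eq_bigr do rewrite mulg1.
Qed.

Theorem group_runs_stack_runs w :
  0 <= group_runs w [::] 1%g - (stack_runs bar w [::])%:R
    <= c / n ^+ 2 * (runs bar w [::])%:R.
Proof.
rewrite subr_ge0 (stack_runs_le w [::]) /=.
exact: (avg_group_runs w [::]).
Qed.

End GroupRuns.

Local Open Scope classical_set_scope.
Local Open Scope complex_scope.
Local Open Scope ring_scope.

(** * Moments of a real Gaussian of variance 1/2 *)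

Section GaussianMoments.
Variable R : realType.
Local Notation mu := (@lebesgue_measure R).
Local Notation g := (@gauss_fun R).

Lemma is_derive_gauss_monomial k (x : R) :
  is_derive x 1 (fun x => x ^+ k * g x) 
    (k%:R * x ^+ k.-1 * g x - 2 * x ^+ k.+1 * g x).
Proof.
rewrite /gauss_fun.
have h : is_derive x 1 (fun x : R => - x ^+ 2) (- 2 * x).
  by apply: is_derive_eq; rewrite /GRing.scale /= mulr1; ring.
have := @is_derive1_comp R expR (fun x : R => - x ^+ 2) x _ _ _ h.
move=> /(_ _ (is_derive_expR _)) h2.
have hX := is_deriveX k (is_derive_id x (1 : R)).
have h3 := is_deriveM hX h2.
rewrite (_ : (fun x => _) = (id ^+ k) * (expR \o (fun x : R => - x ^+ 2))); last first.
  by apply/funext => y; rewrite /= !fctE.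
apply: is_derive_eq.
rewrite /GRing.scale /= !fctE [x ^+ k.+1]exprS.
by move: (expR _) (x ^+ k) (x ^+ k.-1) => a b c; ring.
Qed.

(** One factor exp(-x^2/2) of the Gaussian absorbs the power of x. *)
Lemma exprn_gauss_bound k : exists2 C : R, 0 <= C &
  forall x, `|x| ^+ k * g x <= C * normal_fun 0 1 x.
Proof.
exists (1 + 2 ^+ k.+1 * k.+1`!%:R).
  by rewrite addr_ge0 // mulr_ge0 // exprn_ge0.
move=> x.
have -> : g x = normal_fun 0 1 x * normal_fun 0 1 x.
  rewrite /gauss_fun /normal_fun -expRD; congr expR.
  by rewrite subr0 expr1n; field.
rewrite mulrA; apply: ler_wpM2r; first exact: normal_fun_ge0.
have ye : 0 <= x ^+ 2 / 2 by rewrite divr_ge0 // sqr_ge0.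
have hE : expR (x ^+ 2 / 2) * normal_fun 0 1 x = 1.
  by rewrite /normal_fun -expRD subr0 expr1n mulNr subrr expR0.
rewrite -ler_pdivlMr ?expR_gt0 //.
have -> : (normal_fun 0 1 x)^-1 = expR (x ^+ 2 / 2).
  by rewrite -[RHS](mulfK (_ : normal_fun 0 1 x != 0)) ?hE ?mul1r // gt_eqF // expR_gt0.
have h1 := expR_ge1Dxn k ye.
(* an even power, to be compared with the exponential series in x^2 / 2 *)
have h2 : `|x| ^+ k <= 1 + `|x| ^+ k.+1.*2.
  have [x1|x1] := leP `|x| 1.
    apply: (@le_trans _ _ 1); first by rewrite exprn_ile1.
    by rewrite lerDl exprn_ge0.
  apply: (@le_trans _ _ (`|x| ^+ k.+1.*2)); last by rewrite lerDr.
  by apply: ler_weXn2l; [exact: ltW|rewrite -addnn -addSnnS leq_addl // ].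
apply: le_trans h2 _; rewrite mulrDl mul1r; apply: lerD.
  by apply: le_trans h1; rewrite lerDl divr_ge0 ?exprn_ge0.
have fk : 0 < (k.+1`!%:R : R) by rewrite ltr0n fact_gt0.
have -> : `|x| ^+ k.+1.*2 = 2 ^+ k.+1 * k.+1`!%:R * ((x ^+ 2 / 2) ^+ k.+1 / k.+1`!%:R).
  rewrite -mul2n exprM real_normK ?num_real // expr_div_n.
  field. by rewrite expf_neq0 // andbT gt_eqF.
apply: ler_wpM2l; first by rewrite mulr_ge0 // exprn_ge0.
by apply: le_trans h1; rewrite lerDr.
Qed.

Lemma integrable_gauss_monomial k :
  mu.-integrable setT (fun x => (x ^+ k * g x)%:E).
Proof.
have [C C0 hC] := exprn_gauss_bound k.
apply: (@le_integrable _ _ _ mu _ measurableT _ (fun x => (C * normal_fun 0 1 x)%:E)).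
- apply/measurable_EFinP; apply: measurable_funM; last exact: measurable_gauss_fun.
  exact: exprn_measurable.
- move=> x _; rewrite /= lee_fin normrM normrX (ger0_norm (gauss_fun_ge0 _)).
  by apply: le_trans (hC x) _; rewrite ger0_norm // mulr_ge0 // normal_fun_ge0.
- have h := integrable_normal_pdf (0 : R) 1.
  rewrite [X in mu.-integrable _ X](_ : _ = (fun x => (C / normal_peak 1)%:E * (normal_pdf 0 1 x)%:E)%E).
    exact: integrableZl.
  apply/funext => x; rewrite -EFinM normal_pdfE ?oner_eq0 //.
  by congr _%:E; rewrite mulrA divfK // gt_eqF // normal_peak_gt0 ?oner_eq0.
Qed.

(** The fundamental theorem of calculus on [-n, n], passing to the limit by
    dominated convergence. *)
Lemma integral_derivative_eq0 (f F : R -> R) : continuous f ->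
  mu.-integrable setT (EFin \o f) ->
  (forall x : R, is_derive x 1 F (f x)) ->
  F n%:R @[n --> \oo] --> 0 -> F (- n%:R) @[n --> \oo] --> 0 ->
  (\int[mu]_x (f x)%:E = 0)%E.
Proof.
move=> cf intf dF Fp Fn.
pose I n := `[- n.+1%:R, n.+1%:R : R]%classic.
have fI n : (\int[mu]_(x in I n) (f x)%:E = (F n.+1%:R - F (- n.+1%:R))%:E)%E.
  have ab : - n.+1%:R < n.+1%:R :> R by rewrite gtrN.
  rewrite EFinB; apply: continuous_FTC2 => //.
  - exact: continuous_subspaceT.
  - have cF x : F y @[y --> x] --> F x.
      by apply: differentiable_continuous; apply/derivable1_diffP; case: (dF x).
    split=> [x _||]; first by case: (dF x).
    - exact: cvg_at_right_filter.
    - exact: cvg_at_left_filter.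
  - by move=> x _; rewrite derive1E; apply: derive_val.
have intI n : mu.-integrable setT ((EFin \o f) \_ (I n)).
  by apply/integrable_restrict => //; [exact: measurable_itv | rewrite setTI; apply: integrableS intf => //; exact: measurable_itv].
have [_ _ cvgI] : [/\ mu.-integrable setT (EFin \o f),
    (\int[mu]_x `|((EFin \o f) \_ (I n)) x - (f x)%:E|)%E @[n --> \oo] --> 0%E &
    (\int[mu]_x ((EFin \o f) \_ (I n)) x)%E @[n --> \oo] --> (\int[mu]_x (f x)%:E)%E].
  apply: (@dominated_convergence _ _ _ mu setT measurableT
    (fun n => (EFin \o f) \_ (I n)) (EFin \o f) (abse \o (EFin \o f))).
  - by move=> n; exact: measurable_int (intI n).
  - exact: measurable_int intf.
  - apply: aeW => x _; apply: cvg_near_cst; near=> n.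
    rewrite patchE ifT // inE /I /= in_itv /= -ler_norml.
    near: n; have [M hM] : exists M : nat, `|x| <= M%:R.
      by exists (Num.truncn `|x|).+1; apply/ltW/Num.Theory.truncnS_gt.
    exists M => // n /= Mn; apply: le_trans hM _; rewrite ler_nat.
    exact: leq_trans Mn _.
  - exact: integrable_abse.
  - by apply: aeW => x n _; rewrite patchE; case: ifP => _; rewrite ?abse0 ?lexx ?abse_ge0 //.
have lim0 : (\int[mu]_x ((EFin \o f) \_ (I n)) x)%E @[n --> \oo] --> 0%:E.
  rewrite (_ : (fun n => _) = EFin \o (fun n => F n.+1%:R - F (- n.+1%:R))); last first.
    by apply/funext => n; rewrite -integral_mkcond fI.
  apply: cvg_EFin; first exact: nearW.
  rewrite -[0]subr0; apply: cvgB.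
    by rewrite (cvg_shiftS (fun n => F n%:R)).
  by rewrite (cvg_shiftS (fun n => F (- n%:R))).
exact: (cvg_unique _ cvgI lim0).
Unshelve. all: by end_near. Qed.

Lemma gauss_monomial_cvg0 k :
  (n%:R ^+ k * g n%:R @[n --> \oo] --> (0 : R)) /\
  ((- n%:R) ^+ k * g (- n%:R) @[n --> \oo] --> (0 : R)).
Proof.
have [C C0 hC] := exprn_gauss_bound k.+1.
have bnd x n : (`|x| = n.+1%:R :> R) -> `|x ^+ k * g x| <= C * n.+1%:R^-1.
  move=> hx; rewrite normrM normrX (ger0_norm (gauss_fun_ge0 _)).
  rewrite -(ler_pM2l (_ : 0 < n.+1%:R)) // [leRHS]mulrCA divff // mulr1.
  rewrite mulrA -[in leLHS]hx -exprS; apply: le_trans (hC x) _.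
  rewrite -[leRHS]mulr1; apply: ler_wpM2l => //.
  by rewrite /normal_fun -[leRHS]expR0 ler_expR mulNr oppr_le0 divr_ge0 ?sqr_ge0 // expr1n.
have lim0 : C * n.+1%:R^-1 @[n --> \oo] --> (0 : R).
  rewrite -[0](mulr0 C); apply: cvgMr; exact: cvg_harmonic.
split; rewrite -cvg_shiftS /=; apply/norm_cvg0P; apply: (squeeze_cvgr _ (cvg_cst 0) lim0);
  near=> n; rewrite normr_ge0 /=; apply: bnd; by rewrite ?normrN normr_nat.
Unshelve. all: by end_near. Qed.

(** The derivative of x^k exp(-x^2) integrates to 0. *)
Lemma gauss_stein k :
  (\int[mu]_x (x ^+ k.+1 * g x)%:E = (k%:R / 2)%:E * \int[mu]_x (x ^+ k.-1 * g x)%:E)%E.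
Proof.
pose f (x : R) := k%:R * x ^+ k.-1 * g x - 2 * x ^+ k.+1 * g x.
have fE : EFin \o f = (fun x => k%:R%:E * (x ^+ k.-1 * g x)%:E - 2%:E * (x ^+ k.+1 * g x)%:E)%E.
  by apply/funext => x; rewrite /f /= EFinB -!EFinM !mulrA.
have i1 := integrableZl measurableT k%:R (integrable_gauss_monomial k.-1).
have i2 := integrableZl measurableT 2 (integrable_gauss_monomial k.+1).
have intf : mu.-integrable setT (EFin \o f) by rewrite fE; apply: integrableB.
have cf : continuous f.
  move=> x; rewrite /f; apply: cvgB; apply: cvgM; try exact: continuous_gauss_fun.
  - by apply: cvgM; [exact: cvg_cst | exact: exprn_continuous].
  - by apply: cvgM; [exact: cvg_cst | exact: exprn_continuous].
have [c1 c2] := gauss_monomial_cvg0 k.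
have := integral_derivative_eq0 cf intf (is_derive_gauss_monomial k) c1 c2.
rewrite [X in X = _ -> _](_ : _ = (\int[mu]_x (EFin \o f) x)%E) // fE.
rewrite integralB // !integralZl //; try exact: integrable_gauss_monomial.
have f1 := integrable_fin_num measurableT (integrable_gauss_monomial k.-1).
have f2 := integrable_fin_num measurableT (integrable_gauss_monomial k.+1).
rewrite -(fineK f1) -(fineK f2) -!EFinM -EFinB => -[] h; congr _%:E.
move: h; set a := fine _; set b := fine _ => h.
lra.
Qed.

Local Notation sd := (Num.sqrt 2^-1 : R).

Lemma normal_pdf_gauss x : normal_pdf 0 sd x = normal_peak sd * g x.
Proof.
rewrite normal_pdfE; last by rewrite gt_eqF // sqrtr_gt0 invr_gt0.
congr (_ * expR _); rewrite sqr_sqrtr ?invr_ge0 // subr0 -mulr_natl mulfV ?divr1 //.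
Qed.

(** The density is the Radon-Nikodym derivative almost everywhere. *)
Lemma ge0_integral_normal_prob s (f : R -> \bar R) : measurable_fun setT f ->
  (forall x, 0 <= f x)%E ->
  (\int[normal_prob 0 s]_x f x = \int[mu]_x (f x * (normal_pdf 0 s x)%:E))%E.
Proof.
move=> mf f0.
have dom := @normal_prob_dominates R 0 s.
rewrite -(Radon_Nikodym_SigmaFinite.change_of_variables dom) //.
apply: ae_eq_integral => //.
- apply: emeasurable_funM => //.
  exact: measurable_int (Radon_Nikodym_SigmaFinite.f_integrable dom).
- apply: emeasurable_funM => //; apply/measurable_EFinP; exact: measurable_normal_pdf.
- apply: ae_eqe_mul2l; apply: integral_ae_eq => //.
  + exact: Radon_Nikodym_SigmaFinite.f_integrable.
  + by apply/measurable_EFinP; exact: measurable_normal_pdf.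
  + by move=> E _ mE; rewrite -Radon_Nikodym_SigmaFinite.f_integral.
Qed.

(** Reduction to [ge0_integral_normal_prob] by positive and negative parts. *)
Lemma integral_normal_prob s (f : R -> R) : measurable_fun setT f ->
  mu.-integrable setT (fun x => (f x * normal_pdf 0 s x)%:E) ->
  (normal_prob 0 s).-integrable setT (EFin \o f) /\
  (\int[normal_prob 0 s]_x (f x)%:E = \int[mu]_x (f x * normal_pdf 0 s x)%:E)%E.
Proof.
move=> mf intf.
have mfE : measurable_fun setT (EFin \o f) by apply/measurable_EFinP.
have p0 := normal_pdf_ge0 (0 : R) s.
have intg : (normal_prob 0 s).-integrable setT (EFin \o f).
  apply/integrableP; split => //.
  rewrite ge0_integral_normal_prob //; last exact: measurableT_comp.
  case/integrableP: intf => _; congr (_ < _)%E; apply: eq_integral => x _.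
  by rewrite /= normrM EFinM (ger0_norm (p0 x)).
split=> //.
rewrite [LHS]integralE [RHS]integralE; congr (_ - _)%E.
- rewrite ge0_integral_normal_prob //; last exact: measurable_funepos.
  apply: eq_integral => x _; rewrite !funeposE -!EFin_max -EFinM; congr _%:E.
  by rewrite maxr_pMl // mul0r.
- rewrite ge0_integral_normal_prob //; last exact: measurable_funeneg.
  apply: eq_integral => x _; rewrite !funenegE -!EFinN -!EFin_max -EFinM; congr _%:E.
  by rewrite maxr_pMl // mul0r mulNr.
Qed.

Definition half_normal_moment k : R :=
  fine (\int[normal_prob 0 sd]_x (x ^+ k)%:E)%E.
Local Notation mom := half_normal_moment.

Lemma integrable_normal_monomial k :
  (normal_prob 0 sd).-integrable setT (fun x => (x ^+ k)%:E).
Proof.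
have [] := @integral_normal_prob sd (fun x => x ^+ k) (exprn_measurable _) _ => //.
under eq_fun do rewrite normal_pdf_gauss mulrCA EFinM.
by apply: integrableZl => //; exact: integrable_gauss_monomial.
Qed.

Lemma half_normal_momentE k : (mom k)%:E =
  ((normal_peak sd)%:E * \int[mu]_x (x ^+ k * g x)%:E)%E.
Proof.
rewrite /mom fineK; last exact: integrable_fin_num (integrable_normal_monomial k).
have [||_ ->] := @integral_normal_prob sd (fun x => x ^+ k).
- exact: exprn_measurable.
- under eq_fun do rewrite normal_pdf_gauss mulrCA EFinM.
  by apply: integrableZl => //; exact: integrable_gauss_monomial.
under eq_integral do rewrite normal_pdf_gauss mulrCA EFinM.
by rewrite integralZl //; exact: integrable_gauss_monomial.
Qed.

Lemma half_normal_moment0 : mom 0 = 1.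
Proof.
apply: EFin_inj; rewrite half_normal_momentE -(integral_normal_pdf (0 : R) sd).
under [RHS]eq_integral do rewrite normal_pdf_gauss EFinM.
rewrite integralZl //; last exact: integrableT_gauss.
by congr (_ * _)%E; apply: eq_integral => x _; rewrite expr0 mul1r.
Qed.

Lemma half_normal_momentS k : mom k.+1 = k%:R / 2 * mom k.-1.
Proof.
apply: EFin_inj; rewrite EFinM !half_normal_momentE gauss_stein.
by rewrite muleCA.
Qed.

End GaussianMoments.

(** * Expectations of products of independent variables *)

Section NonnegProducts.
Import HBSimple HBNNSimple.
Context {d : measure_display} {T : measurableType d} {R : realType}.
Variable P : probability T R.

Lemma cvg_integral_nondecreasing (u : nat -> T -> R) (f : T -> R) :
  (forall n, measurable_fun setT (u n)) -> (forall n w, 0 <= u n w) ->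
  (forall n m w, (n <= m)%N -> u n w <= u m w) ->
  (forall w, (u n w)%:E @[n --> \oo] --> (f w)%:E) ->
  (\int[P]_w (u n w)%:E)%E @[n --> \oo] --> (\int[P]_w (f w)%:E)%E.
Proof.
move=> mu u0 nu cu.
rewrite (eq_integral (fun w => limn (fun n => (u n w)%:E))); last first.
  by move=> w _; rewrite (cvg_lim _ (cu w)).
apply: cvg_monotone_convergence => //.
- by move=> n; apply/measurable_EFinP.
- by move=> n w _; rewrite lee_fin.
- by move=> w _ n m nm; rewrite lee_fin; exact: nu.
Qed.

(** The hypothesis says that V is uncorrelated with W on events of V; it passes
    to simple functions of V, then to V by monotone convergence. *)
Lemma ge0_integral_mul_indep (V W : T -> R) (c : R) :
  measurable_fun setT V -> measurable_fun setT W ->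
  (forall w, 0 <= V w) -> (forall w, 0 <= W w) -> 0 <= c ->
  (forall B, measurable B ->
     (\int[P]_w (\1_(V @^-1` B) w * W w)%:E = P (V @^-1` B) * c%:E)%E) ->
  (\int[P]_w (V w * W w)%:E = (\int[P]_w (V w)%:E) * c%:E)%E.
Proof.
move=> mV mW V0 W0 c0 H.
have mid : measurable_fun [set: R] (fun x : R => (Num.max x 0)%:E).
  by apply/measurable_EFinP; apply: measurable_maxr.
pose h := nnsfun_approx measurableT mid.
have hcvg w : (h n (V w))%:E @[n --> \oo] --> (V w)%:E.
  have /= := @cvg_nnsfun_approx _ _ R _ measurableT _ mid _ (V w) I.
  rewrite (max_l (V0 w)); apply => x _; by rewrite lee_fin le_max lexx orbT.
have hnd x n m : (n <= m)%N -> h n x <= h m x.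
  by move=> nm; have /lefP := nd_nnsfun_approx measurableT mid nm; apply.
have mhV n : measurable_fun setT (fun w => h n (V w)).
  by apply: (measurableT_comp (measurable_funP (h n)) mV).
have h0 n x : 0 <= h n x by exact: fun_ge0.
have step n : (\int[P]_w (h n (V w) * W w)%:E = (\int[P]_w (h n (V w))%:E) * c%:E)%E.
  pose s := fset_set (range (h n)).
  pose E i := V @^-1` (h n @^-1` [set s`_i]).
  have mB i : measurable (h n @^-1` [set s`_i]) by exact: measurable_sfunP.
  have mE i : measurable (E i) by rewrite -[E i]setTI; exact: mV.
  have s0 i : (i < #|`s|)%N -> 0 <= s`_i.
    move=> hi; have : s`_i \in s by exact: mem_nth.
    by rewrite in_fset_set // inE => -[x _ <-].
  have hE w : h n (V w) = \sum_(i < #|`s|) s`_i * \1_(E i) w.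
    by rewrite fimfunEord.
  transitivity (\sum_(i < #|`s|) (s`_i)%:E * (P (E i) * c%:E))%E.
    rewrite (eq_integral (fun w => \sum_(i < #|`s|) (s`_i)%:E * (\1_(E i) w * W w)%:E)%E); last first.
      by move=> w _; rewrite hE mulr_suml sumEFin; congr _%:E;
         apply: eq_bigr => i _; rewrite mulrA.
    rewrite ge0_integral_sum //; last 2 first.
    - move=> i; apply: measurable_funeM; apply/measurable_EFinP.
      by apply: measurable_funM => //; exact: measurable_indic.
    - by move=> i w _; rewrite -EFinM lee_fin !mulr_ge0 // s0.
    apply: eq_bigr => i _; rewrite ge0_integralZl //; last 3 first.
    - by apply/measurable_EFinP; apply: measurable_funM => //; exact: measurable_indic.
    - by move=> w _; rewrite lee_fin mulr_ge0.
    - by rewrite lee_fin s0.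
    by rewrite H.
  rewrite (eq_integral (fun w => \sum_(i < #|`s|) (s`_i)%:E * (\1_(E i) w)%:E)%E); last first.
    by move=> w _; rewrite hE sumEFin.
  rewrite ge0_integral_sum //; last 2 first.
  - move=> i; apply: measurable_funeM; apply/measurable_EFinP; exact: measurable_indic.
  - by move=> i w _; rewrite -EFinM lee_fin !mulr_ge0 // s0.
  rewrite ge0_sume_distrl; last first.
    by move=> i _; apply: integral_ge0 => w _; rewrite -EFinM lee_fin mulr_ge0 // s0.
  apply: eq_bigr => i _; rewrite ge0_integralZl //; last 2 first.
  - by apply/measurable_EFinP; exact: measurable_indic.
  - by rewrite lee_fin s0.
  by rewrite integral_indic // setIT muleA.
have l1 : (\int[P]_w (h n (V w) * W w)%:E)%E @[n --> \oo] --> (\int[P]_w (V w * W w)%:E)%E.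
  apply: cvg_integral_nondecreasing.
  - by move=> n; exact: measurable_funM.
  - by move=> n w; rewrite mulr_ge0.
  - by move=> n m w nm; apply: ler_wpM2r => //; exact: hnd.
  - by move=> w; under eq_fun do rewrite EFinM; rewrite EFinM; apply: cvgeZr.
have l2 : (\int[P]_w (h n (V w))%:E)%E @[n --> \oo] --> (\int[P]_w (V w)%:E)%E.
  by apply: cvg_integral_nondecreasing => // n m w nm; exact: hnd.
have l3 : (\int[P]_w (h n (V w) * W w)%:E)%E @[n --> \oo] --> (\int[P]_w (V w)%:E * c%:E)%E.
  under eq_fun do rewrite step.
  exact: cvgeZr.
exact: (cvg_unique _ l1 l3).
Qed.

(** Membership of the preimages in [F] is asked for besides measurability because
    [F] ranges over set systems that carry no measurable type. *)
Definition rv_in (F : set (set T)) (U : T -> R) :=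
  measurable_fun setT U /\ forall B, measurable B -> F (U @^-1` B).

(** Starting from indicators of events, where the rule is the definition of
    independence, the functions are put in one at a time. *)
Lemma indep_ge0_integral_prod (I : finType) (F : I -> set (set T)) (U : I -> T -> R) :
  mutually_independent P F -> (forall i, rv_in (F i) (U i)) ->
  (forall i w, 0 <= U i w) ->
  (forall i, P.-integrable setT (EFin \o U i)) ->
  (\int[P]_w (\prod_i U i w)%:E = \prod_i \int[P]_w (U i w)%:E)%E.
Proof.
move=> indep UF U0 intU.
suff H (s : seq I) (V : I -> T -> R) : uniq s ->
   (forall i, measurable_fun setT (V i)) -> (forall i w, 0 <= V i w) ->
   (forall i, P.-integrable setT (EFin \o V i)) ->
   (forall i, i \in s -> rv_in (F i) (V i)) ->
   (forall i, i \notin s -> exists E, [/\ measurable E, F i E & V i = \1_E]) ->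
   (\int[P]_w (\prod_i V i w)%:E = \prod_i \int[P]_w (V i w)%:E)%E.
  apply: (H (enum I) U); rewrite ?enum_uniq //.
  - by move=> i; case: (UF i).
  - by move=> i; rewrite mem_enum.
elim: s V => [|i s IH] V us mV V0 intV hin hout.
  have {}hout i := hout i isT.
  pose E i := projT1 (cid (hout i)).
  have hE i : [/\ measurable (E i), F i (E i) & V i = \1_(E i)] by rewrite /E; case: cid.
  have := indep [set: I]%SET E (fun i _ => let: And3 _ h _ := hE i in h).
  rewrite (eq_bigl xpredT); last by move=> i; rewrite inE.
  rewrite (_ : [set` [set: I]%SET] = setT); last by apply/seteqP; split => // x _ /=; rewrite inE.
  rewrite [X in _ = X -> _](eq_bigr (fun i => \int[P]_w (V i w)%:E)%E); last first.
    by move=> i _; case: (hE i) => mE _ ->; rewrite integral_indic // setIT.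
  move=> <-.
  have mI : measurable (\bigcap_i E i).
    apply: fin_bigcap_measurable; first exact: finite_finset; by move=> i _; case: (hE i).
  rewrite -[RHS](_ : \int[P]_w (\1_(\bigcap_i E i) w)%:E = _)%E; last first.
    by rewrite integral_indic // setIT.
  apply: eq_integral => w _; congr _%:E.
  rewrite (eq_bigr (fun i => \1_(E i) w)); last by move=> i _; case: (hE i) => _ _ ->.
  rewrite indicE; case: (boolP (w \in _)) => [|] hw.
    rewrite big1 // => i _; rewrite indicE mem_set //; move: hw; rewrite inE; exact.
  have [i hi] : exists i, ~ E i w.
    apply: contrapT => hn; move/negP: hw; apply; rewrite inE => i _.
    by apply: contrapT => hi; apply: hn; exists i.
  by rewrite (bigD1 i) //= indicE memNset ?mul0r.
move: us => /= /andP[nis us].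
have fVi j : exists2 a : R, 0 <= a & (\int[P]_w (V j w)%:E = a%:E)%E.
  exists (fine (\int[P]_w (V j w)%:E)%E); first by apply: fine_ge0; apply: integral_ge0 => w _; rewrite lee_fin.
  by rewrite fineK //; exact: integrable_fin_num (intV j).
have [c c0 hc] : exists2 c : R, 0 <= c &
    (\prod_(j | j != i) \int[P]_w (V j w)%:E)%E = c%:E.
  apply: (big_ind (fun x : \bar R => exists2 c : R, 0 <= c & x = c%:E)).
  - by exists 1.
  - by move=> _ _ [a a0 ->] [b b0 ->]; exists (a * b); rewrite ?mulr_ge0.
  - by move=> j _; exact: fVi.
rewrite (bigD1 i) //= hc.
under eq_integral do rewrite (bigD1 i) //=.
apply: ge0_integral_mul_indep => //.
- by under eq_fun do rewrite -big_filter; apply: measurable_prod => j _.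
- by move=> w; apply: prodr_ge0.
- move=> B mB.
  have [_ hFi] := hin i (mem_head _ _).
  (* the last function replaced by an indicator, to apply the induction *)
pose V' j := if j == i then (\1_(V i @^-1` B) : T -> R) else V j.
  have mE : measurable (V i @^-1` B) by rewrite -[X in measurable X]setTI; exact: mV.
  have mI : measurable_fun setT (\1_(V i @^-1` B) : T -> R) by exact: measurable_indic.
  have := IH V' us.
  have V'i : V' i = \1_(V i @^-1` B) by rewrite /V' eqxx.
  have V'j j : j != i -> V' j = V j by rewrite /V' => /negPf ->.
  rewrite (bigD1 i) //= V'i integral_indic // setIT.
  rewrite (eq_bigr (fun j => \int[P]_w (V j w)%:E)%E); last by move=> j /V'j ->.
  rewrite hc => <-.
  + apply: eq_integral => w _; rewrite [in RHS](bigD1 i) //= V'i.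
    by congr (_ * _)%:E; apply: eq_bigr => j /V'j ->.
  + by move=> j; rewrite /V'; case: ifP.
  + by move=> j w; rewrite /V'; case: ifP.
  + move=> j; rewrite /V'; case: ifP => // _.
    exact: integrable_indic.
  + move=> j js; rewrite V'j; first by apply: hin; rewrite inE js orbT.
    by apply: contraNneq nis => <-.
  + move=> j js; case: (eqVneq j i) => [->|ji].
      by exists (V i @^-1` B); rewrite V'i; split => //; exact: hFi.
    by rewrite V'j //; apply: hout; rewrite inE negb_or ji.
Qed.

End NonnegProducts.

Section ComplexExpectation.
Context {d : measure_display} {T : measurableType d} {R : realType}.
Variable P : probability T R.
Implicit Types (Z : T -> R[i]) (f : T -> R).

Definition cintegrable Z := forall t, P.-integrable setT (EFin \o re_im Z t).

Lemma integral_fineK f : P.-integrable setT (EFin \o f) ->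
  (\int[P]_w (f w)%:E = (fine (\int[P]_w (f w)%:E))%:E)%E.
Proof. by move=> h; rewrite fineK //; exact: integrable_fin_num. Qed.

Lemma cexpectationE Z : cexpectation P Z =
  Complex (fine (\int[P]_w (complex.Re (Z w))%:E)%E)
          (fine (\int[P]_w (complex.Im (Z w))%:E)%E).
Proof. by rewrite /cexpectation unlock. Qed.

Lemma cintegrable_real f : P.-integrable setT (EFin \o f) ->
  cintegrable (fun w => (f w)%:C).
Proof.
move=> h [] //; apply: (eq_integrable measurableT (cst 0%E)) => //.
exact: integrable0.
Qed.

Lemma cexpectation_real f :
  cexpectation P (fun w => (f w)%:C) = (fine (\int[P]_w (f w)%:E)%E)%:C.
Proof. by rewrite cexpectationE /= integral0. Qed.

Lemma cintegrableD Z Z' : cintegrable Z -> cintegrable Z' ->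
  cintegrable (fun w => Z w + Z' w).
Proof.
move=> h h' t.
have := integrableD measurableT (h t) (h' t); apply: eq_integrable => // w _.
by rewrite /re_im /=; case: t; case: (Z w) (Z' w) => [a b] [a' b'].
Qed.

Lemma cexpectationD Z Z' : cintegrable Z -> cintegrable Z' ->
  cexpectation P (fun w => Z w + Z' w) = cexpectation P Z + cexpectation P Z'.
Proof.
move=> h h'; rewrite !cexpectationE.
have H t : fine (\int[P]_w (re_im (fun w => Z w + Z' w) t w)%:E)%E =
   fine (\int[P]_w (re_im Z t w)%:E)%E + fine (\int[P]_w (re_im Z' t w)%:E)%E.
  rewrite -fineD; [|exact: integrable_fin_num (h t)|exact: integrable_fin_num (h' t)].
  rewrite -integralD //; [|exact: h|exact: h']; congr fine; apply: eq_integral => w _.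
  by rewrite /re_im /=; case: t; case: (Z w) (Z' w) => [a b] [a' b'].
by apply/eqP; rewrite eq_complex /=; apply/andP; split; apply/eqP; [exact: (H false)|exact: (H true)].
Qed.

Lemma cintegrableZ (k : R[i]) Z : cintegrable Z -> cintegrable (fun w => k * Z w).
Proof.
move=> h; case: k => a b; case.
- have := integrableD measurableT (integrableZl measurableT a (h true))
    (integrableZl measurableT b (h false)).
  apply: eq_integrable => // w _.
  by rewrite /re_im /=; case: (Z w) => x y /=; rewrite -!EFinM -EFinD.
- have := integrableB measurableT (integrableZl measurableT a (h false))
    (integrableZl measurableT b (h true)).
  apply: eq_integrable => // w _.
  by rewrite /re_im /=; case: (Z w) => x y /=; rewrite -!EFinM -EFinB.
Qed.

Lemma cexpectationZ (k : R[i]) Z : cintegrable Z ->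
  cexpectation P (fun w => k * Z w) = k * cexpectation P Z.
Proof.
move=> h; rewrite !cexpectationE; case: k => a b.
have iZ c t := integrableZl measurableT c (h t).
have fZ t := integral_fineK (h t).
have hZ c t : (\int[P]_w (c%:E * (re_im Z t w)%:E) = c%:E * \int[P]_w (re_im Z t w)%:E)%E.
  exact: (integralZl measurableT (h t)).
apply/eqP; rewrite eq_complex /=; apply/andP; split; apply/eqP.
- transitivity (fine (\int[P]_w (a%:E * (re_im Z false w)%:E - b%:E * (re_im Z true w)%:E))%E).
    congr fine; apply: eq_integral => w _; rewrite /re_im /=.
    by case: (Z w) => x y /=; rewrite -!EFinM -EFinB.
  have -> : (\int[P]_w (a%:E * (re_im Z false w)%:E - b%:E * (re_im Z true w)%:E) =
      \int[P]_w (a%:E * (re_im Z false w)%:E) - \int[P]_w (b%:E * (re_im Z true w)%:E))%E.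
    exact: (integralB measurableT (iZ a false) (iZ b true)).
  by rewrite !hZ (fZ false) (fZ true) -!EFinM -EFinB.
- transitivity (fine (\int[P]_w (a%:E * (re_im Z true w)%:E + b%:E * (re_im Z false w)%:E))%E).
    congr fine; apply: eq_integral => w _; rewrite /re_im /=.
    by case: (Z w) => x y /=; rewrite -!EFinM -EFinD.
  have -> : (\int[P]_w (a%:E * (re_im Z true w)%:E + b%:E * (re_im Z false w)%:E) =
      \int[P]_w (a%:E * (re_im Z true w)%:E) + \int[P]_w (b%:E * (re_im Z false w)%:E))%E.
    exact: (integralD measurableT (iZ a true) (iZ b false)).
  by rewrite !hZ (fZ false) (fZ true) -!EFinM -EFinD.
Qed.

Lemma cintegrable0 : cintegrable (fun=> 0).
Proof.
by case; apply: (eq_integrable measurableT (cst 0%E)) => //; exact: integrable0.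
Qed.

Lemma cexpectation0 : cexpectation P (fun=> 0) = 0.
Proof. by rewrite cexpectationE /= integral0. Qed.

Lemma cintegrable_sum (I : Type) (r : seq I) (Q : pred I) (Z : I -> T -> R[i]) :
  (forall i, Q i -> cintegrable (Z i)) ->
  cintegrable (fun w => \sum_(i <- r | Q i) Z i w).
Proof.
move=> h; elim: r => [|i r IH].
  by under eq_fun do rewrite big_nil; exact: cintegrable0.
under eq_fun do rewrite big_cons; case: (boolP (Q i)) => hi //.
by apply: cintegrableD => //; exact: h.
Qed.

Lemma cexpectation_sum (I : Type) (r : seq I) (Q : pred I) (Z : I -> T -> R[i]) :
  (forall i, Q i -> cintegrable (Z i)) ->
  cexpectation P (fun w => \sum_(i <- r | Q i) Z i w) =
  \sum_(i <- r | Q i) cexpectation P (Z i).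
Proof.
move=> h; elim: r => [|i r IH].
  by under eq_fun do rewrite big_nil; rewrite big_nil cexpectation0.
under eq_fun do rewrite big_cons; rewrite big_cons; case: (boolP (Q i)) => hi //.
by rewrite cexpectationD ?IH //; [exact: h | exact: cintegrable_sum].
Qed.

(** The positive and negative parts of the real and imaginary parts. *)
Definition nonneg_part (k : bool * bool) Z w : R :=
  Num.max (if k.2 then - re_im Z k.1 w else re_im Z k.1 w) 0.

Definition nonneg_part_coef (k : bool * bool) : R[i] :=
  (if k.1 then 'i else 1) * (if k.2 then - 1 else 1).

Lemma nonneg_part_sum Z w : Z w = \sum_k nonneg_part_coef k * (nonneg_part k Z w)%:C.
Proof.
rewrite -(pair_bigA _ (fun i j => nonneg_part_coef (i, j) * (nonneg_part (i, j) Z w)%:C)) /=.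
rewrite big_bool !big_bool /= /nonneg_part_coef /nonneg_part /re_im /=.
have maxB (x : R) : x = Num.max x 0 - Num.max (- x) 0.
  have [x0|x0] := leP 0 x; have [y0|y0] := leP 0 (- x); lra.
case: (Z w) => a b /=; apply/eqP; rewrite eq_complex /=.
have := maxB a; have := maxB b.
set a1 := Num.max a 0; set a2 := Num.max (- a) 0; set b1 := Num.max b 0; set b2 := Num.max (- b) 0.
by move=> -> ->; apply/andP; split; apply/eqP; ring.
Qed.

Lemma nonneg_part_ge0 k Z w : 0 <= nonneg_part k Z w.
Proof. by rewrite /nonneg_part le_max lexx orbT. Qed.

Lemma measurable_max0 (b : bool) :
  measurable_fun [set: R] (fun x : R => Num.max (if b then - x else x) 0).
Proof. by apply: measurable_maxr => //; case: b => //; exact: measurable_funN. Qed.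

Lemma rv_in_nonneg_part F k Z : rv_in F (re_im Z k.1) -> rv_in F (nonneg_part k Z).
Proof.
case=> mZ FZ; split.
  exact: (measurableT_comp (measurable_max0 k.2) mZ).
move=> B mB.
have := FZ _ (measurable_max0 k.2 measurableT mB); rewrite setTI.
by congr F.
Qed.

Lemma integrable_nonneg_part k Z : cintegrable Z -> P.-integrable setT (EFin \o nonneg_part k Z).
Proof.
move=> h; have mZ : measurable_fun setT (re_im Z k.1).
  by apply/measurable_EFinP; exact: measurable_int (h k.1).
apply: (@le_integrable _ _ _ P _ measurableT _ (EFin \o re_im Z k.1)) => //.
  apply/measurable_EFinP; exact: (measurableT_comp (measurable_max0 k.2) mZ).
move=> w _; rewrite /= lee_fin ger0_norm ?nonneg_part_ge0 // /nonneg_part ge_max normr_ge0 andbT.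
by case: ifP => _; rewrite ?ler_norm // -normrN ler_norm.
Qed.

Lemma indep_integrable_nonneg_part (I : finType) (F : I -> set (set T)) (U : I -> T -> R[i])
    (k : I -> bool * bool) :
  mutually_independent P F -> (forall i t, rv_in (F i) (re_im (U i) t)) ->
  (forall i, cintegrable (U i)) ->
  P.-integrable setT (EFin \o (fun w => \prod_i nonneg_part (k i) (U i) w)) /\
  (\int[P]_w (\prod_i nonneg_part (k i) (U i) w)%:E =
   (\prod_i fine (\int[P]_w (nonneg_part (k i) (U i) w)%:E)%E)%:E)%E.
Proof.
move=> indep hF hU.
have E : (\int[P]_w (\prod_i nonneg_part (k i) (U i) w)%:E =
   (\prod_i fine (\int[P]_w (nonneg_part (k i) (U i) w)%:E)%E)%:E)%E.
  rewrite (indep_ge0_integral_prod indep) -?prodEFin.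
  - by apply: eq_bigr => i _; apply: integral_fineK; exact: integrable_nonneg_part.
  - by move=> i; apply: rv_in_nonneg_part.
  - by move=> i w; exact: nonneg_part_ge0.
  - by move=> i; exact: integrable_nonneg_part.
split=> //; apply/integrableP; split.
  apply/measurable_EFinP; apply: measurable_prod => i _.
  by case: (rv_in_nonneg_part (k := k i) (hF i (k i).1)).
rewrite (eq_integral (fun w => (\prod_i nonneg_part (k i) (U i) w)%:E)); first by rewrite E ltry.
by move=> w _; rewrite /= ger0_norm // prodr_ge0 // => i _; exact: nonneg_part_ge0.
Qed.

(** Both sides are multilinear, so each variable may be replaced by its four
    nonnegative parts. *)
Lemma indep_cexpectation_prod (I : finType) (F : I -> set (set T)) (U : I -> T -> R[i]) :
  mutually_independent P F -> (forall i t, rv_in (F i) (re_im (U i) t)) ->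
  (forall i, cintegrable (U i)) ->
  cintegrable (fun w => \prod_i U i w) /\
  cexpectation P (fun w => \prod_i U i w) = \prod_i cexpectation P (U i).
Proof.
move=> indep hF hU.
have Ew : (fun w => \prod_i U i w) = (fun w =>
   \sum_(f : {ffun I -> bool * bool})
     (\prod_i nonneg_part_coef (f i)) * (\prod_i nonneg_part (f i) (U i) w)%:C).
  apply/funext => w; under eq_bigr do rewrite nonneg_part_sum.
  rewrite bigA_distr_bigA /=; apply: eq_bigr => f _.
  by rewrite big_split rmorph_prod.
have ip (f : {ffun I -> bool * bool}) := indep_integrable_nonneg_part f indep hF hU.
have ci (f : {ffun I -> bool * bool}) : cintegrable (fun w => (\prod_i nonneg_part_coef (f i)) *
    (\prod_i nonneg_part (f i) (U i) w)%:C).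
  by apply: cintegrableZ; apply: cintegrable_real; case: (ip f).
rewrite Ew; split; first by apply: cintegrable_sum => f _; exact: ci.
rewrite cexpectation_sum; last by move=> f _; exact: ci.
have EU i : cexpectation P (U i) = \sum_k nonneg_part_coef k * (fine (\int[P]_w (nonneg_part k (U i) w)%:E)%E)%:C.
  have ik k := integrable_nonneg_part k (hU i).
  rewrite [X in cexpectation P X](_ : _ = (fun w => \sum_k nonneg_part_coef k * (nonneg_part k (U i) w)%:C)).
    rewrite cexpectation_sum.
      by apply: eq_bigr => k _; rewrite cexpectationZ ?cexpectation_real //; exact: cintegrable_real.
    by move=> k _; apply: cintegrableZ; exact: cintegrable_real.
  by apply/funext => w; exact: nonneg_part_sum.
under [RHS]eq_bigr do rewrite EU.
rewrite bigA_distr_bigA /=; apply: eq_bigr => f _.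
rewrite cexpectationZ; last by apply: cintegrable_real; case: (ip f).
by rewrite cexpectation_real [RHS]big_split; case: (ip f) => _ -> /=; rewrite rmorph_prod.
Qed.

End ComplexExpectation.

(** * Moments of a complex Gaussian *)

Section SigmaMembership.
Context {d : measure_display} {T : measurableType d} {R : realType}.

Definition rv_preimages (I : Type) (X : I -> T -> R) : set (set T) :=
  \bigcup_i preimage_set_system setT (X i) measurable.

Lemma sigma_rv_sub (I : Type) (X : I -> T -> R) :
  (forall i, measurable_fun setT (X i)) -> sigma_rv X `<=` measurable.
Proof.
move=> mX; apply: smallest_sub; first exact: sigma_algebra_measurable.
by move=> _ [i _ [B mB <-]]; exact: mX.
Qed.

Lemma measurable_fun_sigma_rv (I : Type) (X : I -> T -> R) i :
  measurable_fun (setT : set (g_sigma_algebraType (rv_preimages X))) (X i).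
Proof. by move=> _ B mB; apply: sub_sigma_algebra; exists i => //; exists B. Qed.

Lemma rv_in_sigma_rv (I : Type) (X : I -> T -> R) (f : T -> R) :
  (forall i, measurable_fun setT (X i)) ->
  measurable_fun (setT : set (g_sigma_algebraType (rv_preimages X))) f ->
  rv_in (sigma_rv X) f.
Proof.
move=> mX mf; have H B : measurable B -> sigma_rv X (f @^-1` B).
  by move=> mB; have := mf measurableT B mB; rewrite setTI.
by split=> // _ B mB; rewrite setTI; apply: (sigma_rv_sub mX); exact: H.
Qed.

End SigmaMembership.

Section GaussianExpectation.
Context {d : measure_display} {T : measurableType d} {R : realType}.
Variable P : probability T R.

Local Notation mom := (@half_normal_moment R).
Local Notation sd := (Num.sqrt 2^-1 : R).

(** Transfer of the moments of the distribution along the variable. *)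
Lemma half_normal_law_moment (Y : T -> R) k : measurable_fun setT Y ->
  (forall B : set R, measurable B -> P (Y @^-1` B) = normal_prob 0 sd B) ->
  P.-integrable setT (fun w => (Y w ^+ k)%:E) /\
  (\int[P]_w (Y w ^+ k)%:E = (mom k)%:E)%E.
Proof.
move=> mY law.
have mk : measurable_fun [set: R] (fun x : R => (x ^+ k)%:E).
  by apply/measurable_EFinP; exact: exprn_measurable.
have ge0E (f : R -> \bar R) : measurable_fun setT f -> (forall x, 0 <= f x)%E ->
    (\int[P]_w f (Y w) = \int[normal_prob 0 sd]_x f x)%E.
  move=> mf f0.
  have mY' : measurable_fun setT (Y : T -> measurableTypeR R) := mY.
  have := @ge0_integral_pushforward _ _ _ (measurableTypeR R) _ _ mY' P setT f
    measurableT mf (fun x _ => f0 x).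
  rewrite preimage_setT => <-.
  exact: (@eq_measure_integral _ _ _ setT (normal_prob 0 sd)
    (measure_function_pushforward__canonical__measure_function_Measure P mY') f
    (fun B mB _ => law B mB)).
have iY : P.-integrable setT (fun w => (Y w ^+ k)%:E).
  apply/integrableP; split.
    by apply/measurable_EFinP; apply: measurable_funX.
  rewrite (ge0E (fun x => `|(x ^+ k)%:E|)%E) //; last exact: measurableT_comp.
  by have /integrableP[] := integrable_normal_monomial R k.
split=> //.
rewrite integralE.
have -> : (\int[P]_w ((fun w => (Y w ^+ k)%:E)^\+ w) =
    \int[normal_prob 0 sd]_x ((fun x => (x ^+ k)%:E)^\+ x))%E.
  rewrite -ge0E //; last exact: measurable_funepos.
  by apply: eq_integral => w _; rewrite !funeposE.
have -> : (\int[P]_w ((fun w => (Y w ^+ k)%:E)^\- w) =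
    \int[normal_prob 0 sd]_x ((fun x => (x ^+ k)%:E)^\- x))%E.
  rewrite -ge0E //; last exact: measurable_funeneg.
  by apply: eq_integral => w _; rewrite !funenegE.
rewrite -integralE /half_normal_moment fineK //.
exact: integrable_fin_num (integrable_normal_monomial R k).
Qed.

Variable Z : T -> R[i].
Hypothesis gZ : std_complex_gaussian P Z.

Lemma cgauss_integrable_pow t k :
  cintegrable P (fun w => (re_im Z t w ^+ k)%:C) /\
  cexpectation P (fun w => (re_im Z t w ^+ k)%:C) = (mom k)%:C.
Proof.
have [mZ law _] := gZ.
have [i1 e1] := half_normal_law_moment k (mZ t) (law t).
by split; [exact: cintegrable_real | rewrite cexpectation_real e1].
Qed.

Lemma cgauss_real_monomial i j :
  cintegrable P (fun w => (re_im Z false w)%:C ^+ i * (re_im Z true w)%:C ^+ j) /\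
  cexpectation P (fun w => (re_im Z false w)%:C ^+ i * (re_im Z true w)%:C ^+ j)
    = (mom i)%:C * (mom j)%:C.
Proof.
have [mZ _ indep] := gZ.
pose U (t : bool) w : R[i] := (re_im Z t w ^+ (if t then j else i))%:C.
have [||h1 h2] := indep_cexpectation_prod (U := U) indep.
- move=> t t'; apply: rv_in_sigma_rv; first by move=> _; exact: mZ.
  case: t'.
    by rewrite (_ : re_im (U t) true = cst 0) //; exact: measurable_cst.
  rewrite (_ : re_im (U t) false = fun w => re_im Z t w ^+ (if t then j else i)) //.
  apply: measurable_funX.
  exact: (@measurable_fun_sigma_rv _ _ _ unit (fun=> re_im Z t) tt).
- by move=> t; case: (cgauss_integrable_pow t (if t then j else i)).
rewrite (_ : (fun w => _ * _) = (fun w => \prod_i0 U i0 w)); last first.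
  by apply/funext => w; rewrite big_bool /= /U /= !rmorphXn mulrC.
split=> //; rewrite h2 big_bool /= mulrC; congr (_ * _).
  by case: (cgauss_integrable_pow false i).
by case: (cgauss_integrable_pow true j).
Qed.

Local Notation X := (fun w => (re_im Z false w)%:C).
Local Notation Y := (fun w => (re_im Z true w)%:C).

(** Mixed monomials in Re Z, Im Z, Z and its conjugate, so that the powers of Z
    can be expanded one factor at a time. *)
Definition gauss_monomial i j a b w : R[i] :=
  X w ^+ i * Y w ^+ j * Z w ^+ a * (Num.conj (Z w)) ^+ b.

Lemma re_im_sum w : Z w = X w + 'i * Y w.
Proof.
rewrite /re_im; case: (Z w) => x y; apply/eqP; rewrite eq_complex /=.
by apply/andP; split; apply/eqP; ring.
Qed.

Lemma conj_re_im_sum w : Num.conj (Z w) = X w - 'i * Y w.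
Proof.
rewrite /re_im; case: (Z w) => x y; apply/eqP; rewrite eq_complex /=.
by apply/andP; split; apply/eqP; ring.
Qed.

Lemma gauss_monomialSa i j a b w : gauss_monomial i j a.+1 b w =
  gauss_monomial i.+1 j a b w + 'i * gauss_monomial i j.+1 a b w.
Proof. rewrite /gauss_monomial [Z w ^+ a.+1]exprS {1}re_im_sum !exprS; ring. Qed.

Lemma gauss_monomialSb i j a b w : gauss_monomial i j a b.+1 w =
  gauss_monomial i.+1 j a b w + (- 'i) * gauss_monomial i j.+1 a b w.
Proof. rewrite /gauss_monomial [_ ^+ b.+1]exprS {1}conj_re_im_sum !exprS; ring. Qed.

Lemma cintegrable_gauss_monomial i j a b : cintegrable P (gauss_monomial i j a b).
Proof.
elim: b i j a => [|b IHb].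
  move=> i j a; elim: a i j => [|a IHa] i j.
    have [h _] := cgauss_real_monomial i j.
    rewrite (_ : gauss_monomial i j 0 0 = fun w => X w ^+ i * Y w ^+ j) //.
    by apply/funext => w; rewrite /gauss_monomial !expr0 !mulr1.
  rewrite (funext (gauss_monomialSa i j a 0)).
  by apply: cintegrableD => //; apply: cintegrableZ.
move=> i j a; rewrite (funext (gauss_monomialSb i j a b)).
by apply: cintegrableD => //; apply: cintegrableZ.
Qed.

Local Notation e i j a b := (cexpectation P (gauss_monomial i j a b)).

Lemma cexp_gauss_monomialSa i j a b : e i j a.+1 b = e i.+1 j a b + 'i * e i j.+1 a b.
Proof.
have c := cintegrable_gauss_monomial.
by rewrite (funext (gauss_monomialSa i j a b)) cexpectationD ?cexpectationZ //; exact: cintegrableZ.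
Qed.

Lemma cexp_gauss_monomialSb i j a b : e i j a b.+1 = e i.+1 j a b - 'i * e i j.+1 a b.
Proof.
have c := cintegrable_gauss_monomial.
rewrite (funext (gauss_monomialSb i j a b)) cexpectationD ?cexpectationZ ?mulNr //.
exact: cintegrableZ.
Qed.

Lemma cexp_gauss_monomial00 i j : e i j 0 0 = (mom i)%:C * (mom j)%:C.
Proof.
have [_ <-] := cgauss_real_monomial i j; congr cexpectation.
by apply/funext => w; rewrite /gauss_monomial !expr0 !mulr1.
Qed.

Lemma half_normal_momentSC k : (mom k.+1)%:C = k%:R / 2 * (mom k.-1)%:C.
Proof. by rewrite half_normal_momentS !rmorphM fmorphV !rmorph_nat. Qed.

Lemma mul_ii : 'i * 'i = -1 :> R[i].
Proof. by apply/eqP; rewrite eq_complex /= !mul0r !mulr0 !mulr1 sub0r addr0 oppr0 !eqxx. Qed.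

(** Integration by parts in the real and in the imaginary part: E[X F] is half of
    E[dF/dX], by induction on the number of factors Z and conj Z. *)
Lemma gauss_stein_re_im a b i j :
  e i.+1 j a b = (i%:R * e i.-1 j a b + a%:R * e i j a.-1 b + b%:R * e i j a b.-1) / 2 /\
  e i j.+1 a b = (j%:R * e i j.-1 a b + 'i * (a%:R * e i j a.-1 b)
                  - 'i * (b%:R * e i j a b.-1)) / 2.
Proof.
have two : (2 : R[i]) != 0 by rewrite pnatr_eq0.
have Hi i' j' a' b' : i'%:R * e i'.-1 j' a'.+1 b' =
    i'%:R * (e i' j' a' b' + 'i * e i'.-1 j'.+1 a' b').
  by case: i' => [|i']; [rewrite !mul0r | rewrite cexp_gauss_monomialSa].
have Hj i' j' a' b' : j'%:R * e i' j'.-1 a'.+1 b' =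
    j'%:R * (e i'.+1 j'.-1 a' b' + 'i * e i' j' a' b').
  by case: j' => [|j']; [rewrite !mul0r | rewrite cexp_gauss_monomialSa].
have Ha i' j' a' b' : a'%:R * e i' j' a' b' =
    a'%:R * (e i'.+1 j' a'.-1 b' + 'i * e i' j'.+1 a'.-1 b').
  by case: a' => [|a']; [rewrite !mul0r | rewrite cexp_gauss_monomialSa].
have Hi' i' j' a' b' : i'%:R * e i'.-1 j' a' b'.+1 =
    i'%:R * (e i' j' a' b' - 'i * e i'.-1 j'.+1 a' b').
  by case: i' => [|i']; [rewrite !mul0r | rewrite cexp_gauss_monomialSb].
have Hj' i' j' a' b' : j'%:R * e i' j'.-1 a' b'.+1 =
    j'%:R * (e i'.+1 j'.-1 a' b' - 'i * e i' j' a' b').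
  by case: j' => [|j']; [rewrite !mul0r | rewrite cexp_gauss_monomialSb].
have Hb i' j' a' b' : b'%:R * e i' j' a' b' =
    b'%:R * (e i'.+1 j' a' b'.-1 - 'i * e i' j'.+1 a' b'.-1).
  by case: b' => [|b']; [rewrite !mul0r | rewrite cexp_gauss_monomialSb].
have nS (n : nat) (x : R[i]) : n.+1%:R * x = n%:R * x + x by rewrite -natr1 mulrDl mul1r.
elim: b a i j => [|b IHb].
  elim=> [|a IHa] i j.
    rewrite !cexp_gauss_monomial00 !half_normal_momentSC /= !(mul0r, mulr0, addr0, subr0).
    by split; field.
  split; rewrite cexp_gauss_monomialSa.
    rewrite (IHa i.+1 j).1 (IHa i j.+1).1 Hi /= (nS a) (Ha i j a).
    by rewrite (nS i) !mul0r; field.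
  rewrite (IHa i.+1 j).2 (IHa i j.+1).2 Hj /= (nS a) (Ha i j a).
  by rewrite (nS j) !mul0r; field.
move=> a i j.
have HSa : a%:R * e i j a.-1 b.+1 = a%:R * (e i.+1 j a.-1 b - 'i * e i j.+1 a.-1 b).
  by rewrite cexp_gauss_monomialSb.
split; rewrite cexp_gauss_monomialSb.
  rewrite (IHb a i.+1 j).1 (IHb a i j.+1).1 Hi' HSa /= (nS b) (Hb i j a b).
  by rewrite (nS i); field.
rewrite (IHb a i.+1 j).2 (IHb a i j.+1).2 Hj' HSa /= (nS b) (Hb i j a b).
by rewrite (nS j); field.
Qed.

(** Adding the two integrations by parts gives E[Z F] = E[dF/d(conj Z)] and its
    conjugate. *)
Lemma gauss_stein_complex a b :
  e 0 0 a.+1 b = b%:R * e 0 0 a b.-1 /\ e 0 0 0 b.+1 = 0.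
Proof.
have two : (2 : R[i]) != 0 by rewrite pnatr_eq0.
have i2 := mul_ii.
split.
  rewrite cexp_gauss_monomialSa; have [-> ->] := gauss_stein_re_im a b 0 0.
  rewrite !mul0r !add0r mulrA mulrBr !mulrA i2; by field.
rewrite cexp_gauss_monomialSb; have [-> ->] := gauss_stein_re_im 0 b 0 0.
rewrite !mul0r !mulr0 !add0r mulrA mulrN !mulrA i2; by field.
Qed.

Lemma gauss_complex_moment a b : e 0 0 a b = (if a == b then a`! else 0)%:R.
Proof.
elim: a b => [|a IH] [|b].
- by rewrite cexp_gauss_monomial00 half_normal_moment0 mulr1.
- by have [_ ->] := gauss_stein_complex 0 b.
- by have [-> _] := gauss_stein_complex a 0; rewrite mul0r.
- have [-> _] := gauss_stein_complex a b.+1; rewrite /= IH eqSS.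
  by case: eqP => [->|_]; rewrite ?mulr0 // -natrM factS.
Qed.

Lemma gauss_power_moment a b :
  cintegrable P (fun w => Z w ^+ a * Num.conj (Z w) ^+ b) /\
  cexpectation P (fun w => Z w ^+ a * Num.conj (Z w) ^+ b)
   = (if a == b then a`! else 0)%:R.
Proof.
rewrite -gauss_complex_moment.
have -> : (fun w => Z w ^+ a * Num.conj (Z w) ^+ b) = gauss_monomial 0 0 a b.
  by apply/funext => w; rewrite /gauss_monomial !expr0 !mul1r.
by split=> //; exact: cintegrable_gauss_monomial.
Qed.

End GaussianExpectation.

(** * Wick's formula for a Gaussian family *)

Section ComplexMeasurable.
Context {d : measure_display} {T : measurableType d} {R : realType}.
Implicit Types Z : T -> R[i].

(** Kept apart from the probability space, to be used with the sub-sigma-algebra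
    generated by an entry. *)
Definition cmeasurable Z := forall t, measurable_fun setT (re_im Z t).

Lemma cmeasurable1 : cmeasurable (fun=> 1).
Proof. by case; exact: measurable_cst. Qed.

Lemma cmeasurableM Z Z' : cmeasurable Z -> cmeasurable Z' ->
  cmeasurable (fun w => Z w * Z' w).
Proof.
move=> h h' [].
  rewrite (_ : re_im _ _ = (fun w => re_im Z false w * re_im Z' true w +
     re_im Z true w * re_im Z' false w)).
    by apply: measurable_funD; apply: measurable_funM.
  by apply/funext => w; rewrite /re_im; case: (Z w) (Z' w) => [a b] [a' b'].
rewrite (_ : re_im _ _ = (fun w => re_im Z false w * re_im Z' false w -
     re_im Z true w * re_im Z' true w)).
  by apply: measurable_funB; apply: measurable_funM.
by apply/funext => w; rewrite /re_im; case: (Z w) (Z' w) => [a b] [a' b'].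
Qed.

Lemma cmeasurableX Z k : cmeasurable Z -> cmeasurable (fun w => Z w ^+ k).
Proof.
move=> h; elim: k => [|k IH]; first exact: cmeasurable1.
by under eq_fun do rewrite exprS; exact: cmeasurableM.
Qed.

Lemma cmeasurable_conj Z : cmeasurable Z -> cmeasurable (fun w => Num.conj (Z w)).
Proof.
move=> h [].
  rewrite (_ : re_im _ _ = (fun w => - re_im Z true w)).
    exact: measurable_funN.
  by apply/funext => w; rewrite /re_im; case: (Z w).
rewrite (_ : re_im _ _ = (fun w => re_im Z false w)) //.
by apply/funext => w; rewrite /re_im; case: (Z w).
Qed.

End ComplexMeasurable.

Section GaussianFamily.
Context {d : measure_display} {T : measurableType d} {R : realType}.
Variable P : probability T R.
Variables (J G : finType) (X : J -> G -> T -> R[i]).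
Hypothesis gauss : forall j g, std_complex_gaussian P (X j g).
Hypothesis indep_entries : forall j,
  mutually_independent P (fun g => sigma_crv (fun _ : unit => X j g)).
Hypothesis indep_families : mutually_independent P (fun j => sigma_crv (X j)).

Lemma sigma_crv_entry j g : sigma_crv (fun _ : unit => X j g) `<=` sigma_crv (X j).
Proof.
apply: smallest_sub; first exact: smallest_sigma_algebra.
move=> A [[u t] _ hA]; apply: sub_sigma_algebra; exists (g, t) => //.
Qed.

(** Grouping the events of a family into one event of its sigma-algebra reduces
    the rule to independence between families, then within each. *)
Lemma all_entries_indep :
  mutually_independent P (fun p : J * G => sigma_crv (fun _ : unit => X p.1 p.2)).
Proof.
move=> K E hE.
pose Kj j := [set g | (j, g) \in K]%SET.
pose A j := \bigcap_(g in [set` Kj j]) E (j, g).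
have hA j : sigma_crv (X j) (A j).
  apply: (@fin_bigcap_measurable _ (g_sigma_algebraType
    (rv_preimages (fun p : G * bool => re_im (X j p.1) p.2)))) => //.
  move=> g /=; rewrite inE => hg; apply: sigma_crv_entry; exact: (hE (j, g)).
have PA j : P (A j) = (\prod_(g in Kj j) P (E (j, g)))%E.
  apply: indep_entries => g; rewrite inE => hg; exact: (hE (j, g)).
have := indep_families (J := [set: J]%SET) (fun j _ => hA j).
rewrite (_ : \bigcap_(i in _) A i = \bigcap_(p in [set` K]) E p); last first.
  apply/seteqP; split => w h.
    by move=> [j g] /= hK; apply: (h j); rewrite /= ?inE.
  by move=> j _ g /=; rewrite inE => hK; apply: (h (j, g)).
move=> ->.
rewrite (eq_bigl xpredT) => [|j]; last by rewrite inE.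
under eq_bigr do rewrite PA.
rewrite pair_big_dep /=; apply: eq_big => [[j g]|[j g] _] //.
by rewrite inE.
Qed.

Definition letter_rv (x : J * G * bool) w : R[i] :=
  if x.2 then Num.conj (X x.1.1 x.1.2 w) else X x.1.1 x.1.2 w.

Lemma prod_count (C : comPzSemiRingType) (L : finType) (f : L -> C) (w : seq L) :
  \prod_(x <- w) f x = \prod_x f x ^+ count_mem x w.
Proof.
elim: w => [|y w IH]; first by rewrite big_nil big1.
rewrite big_cons IH (bigD1 y) //= [RHS](bigD1 y) //= eqxx exprS -!mulrA.
by congr (_ * (_ * _)); apply: eq_bigr => x xy; rewrite eq_sym (negPf xy).
Qed.

(** Wick's formula. By independence the expectation factors over the entries, and
    E[Z^a conj(Z)^b] is the number of ways to pair a letters with b. *)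
Theorem cexpectation_gaussian_word (w : seq (J * G * bool)) :
  cintegrable P (fun o => \prod_(x <- w) letter_rv x o) /\
  cexpectation P (fun o => \prod_(x <- w) letter_rv x o)
    = (runs (@flip _) w [::])%:R.
Proof.
pose U (i : J * G) o := X i.1 i.2 o ^+ occ false i w * Num.conj (X i.1 i.2 o) ^+ occ true i w.
have -> : (fun o => \prod_(x <- w) letter_rv x o) = (fun o => \prod_i U i o).
  apply/funext => o; rewrite prod_count.
  rewrite -(pair_bigA _ (fun i t => letter_rv (i, t) o ^+ count_mem (i, t) w)) /=.
  by apply: eq_bigr => i _; rewrite big_bool /= mulrC.
have mX j g : cmeasurable (X j g) by case: (gauss j g).
have := indep_cexpectation_prod (U := U) all_entries_indep.
case.
- move=> i t; apply: rv_in_sigma_rv; first by move=> [u t']; exact: mX.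
  apply: (@cmeasurableM _ (g_sigma_algebraType _)); first apply: cmeasurableX.
    move=> t'; exact: (@measurable_fun_sigma_rv _ _ _ _ (fun p : unit * bool => re_im (X i.1 i.2) p.2) (tt, t')).
  apply: cmeasurableX; apply: cmeasurable_conj.
  move=> t'; exact: (@measurable_fun_sigma_rv _ _ _ _ (fun p : unit * bool => re_im (X i.1 i.2) p.2) (tt, t')).
- by move=> i; case: (gauss_power_moment (gauss i.1 i.2) (occ false i w) (occ true i w)).
move=> hU ->; split => //.
rewrite runs_from_empty natr_prod; apply: eq_bigr => i _.
by case: (gauss_power_moment (gauss i.1 i.2) (occ false i w) (occ true i w)) => _ ->.
Qed.

End GaussianFamily.

(** * Traces of words in the convolution matrices *)

Section LabelSums.
Variables (L : eqType) (bar : L -> L) (G : finGroupType) (K : numFieldType).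

(** The sum of F over the labellings of [w] whose product is [v]. *)
Fixpoint label_sum (w : seq L) (F : seq (L * G) -> K) (v : G) : K :=
  if w is l :: w' then
    \sum_u label_sum w' (fun t => F ((l, u) :: t)) (u^-1 * v)%g
  else (v == 1%g)%:R * F [::].

Lemma eq_label_sum w F F' v : F =1 F' -> label_sum w F v = label_sum w F' v.
Proof.
elim: w F F' v => [|l w IH] F F' v h /=; first by rewrite h.
by apply: eq_bigr => u _; apply: IH => t.
Qed.

Lemma label_sumZ w a F v : label_sum w (fun t => a * F t) v = a * label_sum w F v.
Proof.
elim: w F v => [|l w IH] F v /=; first by rewrite mulrCA.
by rewrite mulr_sumr; apply: eq_bigr => u _.
Qed.

Lemma label_sumD w F F' v :
  label_sum w (fun t => F t + F' t) v = label_sum w F v + label_sum w F' v.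
Proof.
elim: w F F' v => [|l w IH] F F' v /=; first by rewrite mulrDr.
by rewrite -big_split; apply: eq_bigr => u _; rewrite IH.
Qed.

Lemma label_sum0 w v : label_sum w (fun=> 0) v = 0.
Proof. by elim: w v => [|l w IH] v /=; rewrite ?mulr0 // big1. Qed.

Lemma label_sum_sum w (I : Type) (r : seq I) (Q : pred I) (F : I -> seq (L * G) -> K) v :
  label_sum w (fun t => \sum_(i <- r | Q i) F i t) v =
  \sum_(i <- r | Q i) label_sum w (F i) v.
Proof.
elim: r => [|i r IH].
  by rewrite big_nil -[RHS](label_sum0 w v); apply: eq_label_sum => t; rewrite big_nil.
rewrite big_cons; case: ifP => Qi; rewrite -IH -?label_sumD; apply: eq_label_sum => t;
  by rewrite big_cons Qi.
Qed.

Definition bar_label (x : L * G) := (bar x.1, (x.2)^-1%g).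

(** In [group_runs] every letter that starts to wait has weight 1/n. There are
    (|w| - |s|) / 2 of them in a complete run, hence the powers of q = sqrt n. *)
Lemma label_sum_runs (q : K) w (s : seq (L * G)) h : q ^+ 2 = #|G|%:R ->
  q ^+ size s * label_sum w (fun t => (runs bar_label t s)%:R) h^-1%g
    = q ^+ size w * group_runs bar K w s h.
Proof.
move=> q2; have q0 : q != 0.
  by apply: contra_eq_neq q2 => ->; rewrite expr0n /= eq_sym cardG_neq0.
elim: w s h => [|l w IH] s h.
  rewrite /= mul1r eq_invg1 -natrM mulnb; case: s => [|x s] /=; rewrite ?expr0 ?mul1r ?andbT //.
  by rewrite andbF mulr0.
rewrite [label_sum _ _ _]/=.
under eq_bigr do under eq_label_sum do rewrite natrD.
under eq_bigr do rewrite label_sumD.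
rewrite big_split /= !mulrDr; congr (_ + _).
  rewrite mulrA !mulr_sumr; apply: eq_bigr => u _.
  have := IH ((l, u) :: s) (h * u)%g; rewrite invMg /= => e.
  apply: (mulfI q0); rewrite mulrA -exprS e -q2 exprS.
  by move: (q ^+ size w) (group_runs _ _ _ _ _) => x B; field.
under eq_bigr do under eq_label_sum do rewrite natr_sum.
under eq_bigr do rewrite label_sum_sum.
rewrite (exchange_big_dep (fun p : (L * G) * seq (L * G) => p.1.1 == bar l)) /=; last first.
  by move=> u p _ /eqP ->.
rewrite !mulr_sumr [LHS]big_seq_cond [RHS]big_seq_cond; apply: eq_bigr => p /andP[ps /eqP e].
rewrite (big_pred1 (p.1.2)^-1%g); last first.
  move=> u; rewrite /bar_label /= -pair_eqE /pair_eq /= e eqxx /=.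
  by rewrite eq_sym (canF_eq invgK).
have /perm_size /= -> := removals_perm ps.
by rewrite !exprS -mulrA -[RHS]mulrA -IH invMg.
Qed.

End LabelSums.
Arguments bar_label {L} bar {G} x.

Section WordTrace.
Context {d : measure_display} {T : measurableType d} {R : realType}.
Variable P : probability T R.
Variables (m : nat) (G : finGroupType) (X : 'I_m -> G -> T -> R[i]).
Hypothesis gauss : forall j g, std_complex_gaussian P (X j g).
Hypothesis indep_entries : forall j,
  mutually_independent P (fun g => sigma_crv (fun _ : unit => X j g)).
Hypothesis indep_families : mutually_independent P (fun j => sigma_crv (X j)).

Local Notation letter := ('I_m * bool)%type.
Local Notation C := R[i].

(** In the adjoint matrix, translation by u has the conjugate of the entry at
    u^-1 as coefficient. *)
Definition entry_of (x : letter * G) : 'I_m * G * bool :=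
  ((x.1.1, if x.1.2 then (x.2)^-1%g else x.2), x.1.2).

Lemma entry_of_inj : injective entry_of.
Proof.
move=> [[j t] u] [[j' t'] u'] [-> e ht]; rewrite -ht in e *.
by case: t e {ht} => [/(can_inj invgK) ->|->].
Qed.

Lemma flip_entry_of x : flip (entry_of x) = entry_of (bar_label (@flip _) x).
Proof. by case: x => [[j []] u]; rewrite /flip /entry_of /= ?invgK. Qed.

Definition label_rv (o : T) (x : letter * G) : C := letter_rv X (entry_of x) o.

Lemma cexpectation_label_word (t : seq (letter * G)) :
  cintegrable P (fun o => \prod_(x <- t) label_rv o x) /\
  cexpectation P (fun o => \prod_(x <- t) label_rv o x)
    = (runs (bar_label (@flip _)) t [::])%:R.
Proof.
have [h1 h2] := cexpectation_gaussian_word gauss indep_entries indep_families (map entry_of t).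
have E : (fun o => \prod_(x <- map entry_of t) letter_rv X x o) =
    (fun o => \prod_(x <- t) label_rv o x) by apply/funext => o; rewrite big_map.
by rewrite E in h1 h2; rewrite -(runs_map entry_of_inj flip_entry_of t [::]) -h2.
Qed.

Lemma cexpectation_label_sum (w : seq letter) (F : T -> seq (letter * G) -> C) v :
  (forall t, cintegrable P (F^~ t)) ->
  cintegrable P (fun o => label_sum w (F o) v) /\
  cexpectation P (fun o => label_sum w (F o) v) =
    label_sum w (fun t => cexpectation P (F^~ t)) v.
Proof.
elim: w F v => [|l w IH] F v hF /=.
  by split; [exact: cintegrableZ | rewrite cexpectationZ].
have {}IH u := IH (fun o t => F o ((l, u) :: t)) (u^-1 * v)%g (fun t => hF _).
split; first by apply: cintegrable_sum => u _; case: (IH u).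
rewrite cexpectation_sum; last by move=> u _; case: (IH u).
by apply: eq_bigr => u _; case: (IH u).
Qed.

Definition letter_mx (l : letter) (o : T) : 'M[C]_#|G| :=
  \matrix_(h, k) label_rv o (l, (enum_val h * (enum_val k)^-1)%g).

Lemma scaled_conv_mxE (l : letter) o :
  scaled_conv_mx (fun g => X l.1 g o) l.2 = (sqrtC #|G|%:R)^-1 *: letter_mx l o.
Proof.
case: l => j t; rewrite /scaled_conv_mx; congr (_ *: _).
apply/matrixP => h k; case: t; rewrite !mxE /label_rv /letter_rv /= ?mxE //.
by rewrite invMg invgK.
Qed.

Lemma prod_letter_mxE (w : seq letter) o h k :
  (\prod_(l <- w) letter_mx l o) h k =
  label_sum w (fun t => \prod_(x <- t) label_rv o x) (enum_val h * (enum_val k)^-1)%g.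
Proof.
elim: w h k => [|l w IH] h k.
  rewrite big_nil /= big_nil mulr1 mxE; congr ((_ : bool)%:R).
  apply/eqP/eqP => [->|]; first by rewrite mulgV.
  by move/eqP; rewrite -eq_mulgV1 => /eqP /enum_val_inj.
rewrite big_cons mxE /=.
rewrite [RHS](reindex (fun i : 'I_#|G| => enum_val h * (enum_val i)^-1)%g); last first.
  exists (fun u => enum_rank (u^-1 * enum_val h)%g) => [i _|u _].
    by rewrite invMg invgK mulgKV enum_valK.
  by rewrite enum_rankK invMg invgK mulKVg.
apply: eq_bigr => i _; rewrite IH mxE -label_sumZ.
rewrite invMg invgK mulgA mulgKV.
by apply: eq_label_sum => t; rewrite big_cons.
Qed.

(** The entries of a product of convolution matrices are again a function of
    h k^-1, so the trace is n times the value at 1, which [label_sum_runs]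
    normalizes. *)
Lemma exp_ntrace_word (w : seq letter) :
  cintegrable P (fun o => \tr (\prod_(l <- w) scaled_conv_mx (fun g => X l.1 g o) l.2)) /\
  #|G|%:R^-1 * cexpectation P
     (fun o => \tr (\prod_(l <- w) scaled_conv_mx (fun g => X l.1 g o) l.2))
   = group_runs (@flip _) C w [::] (1%g : G).
Proof.
set q : C := sqrtC #|G|%:R.
have q2 : q ^+ 2 = #|G|%:R by rewrite sqrtCK.
have n0 : (#|G|%:R : C) != 0 by exact: cardG_neq0.
have q0 : q != 0 by rewrite sqrtC_eq0.
pose S o := label_sum w (fun t => \prod_(x <- t) label_rv o x) (1%g : G).
have -> : (fun o => \tr (\prod_(l <- w) scaled_conv_mx (fun g => X l.1 g o) l.2)) =
    (fun o => (q^-1 ^+ size w * #|G|%:R) * S o).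
  apply/funext => o; under eq_bigr do rewrite scaled_conv_mxE -/q.
  have -> : \prod_(l <- w) (q^-1 *: letter_mx l o) =
      q^-1 ^+ size w *: \prod_(l <- w) letter_mx l o.
    elim: (w) => [|l w' IH]; first by rewrite !big_nil expr0 scale1r.
    by rewrite !big_cons IH -[LHS]scalemxAl -scalemxAr scalerA exprS.
  rewrite mxtraceZ -mulrA; congr (_ * _).
  rewrite /mxtrace (eq_bigr (fun=> S o)); last by move=> h _; rewrite prod_letter_mxE mulgV.
  by rewrite sumr_const card_ord mulr_natl.
have [h1 h2] := cexpectation_label_sum w (F := fun o t => \prod_(x <- t) label_rv o x) 1%g
  (fun t => (cexpectation_label_word t).1).
split; first exact: cintegrableZ.
rewrite cexpectationZ // h2.
rewrite (@eq_label_sum _ _ _ _ _ (fun t => (runs (bar_label (@flip _)) t [::])%:R)); last first.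
  by move=> t; case: (cexpectation_label_word t).
have := label_sum_runs (@flip _) w [::] 1%g q2; rewrite /= expr0 mul1r invg1 => ->.
by rewrite mulrA [_^-1 * _]mulrC mulfK // mulrA -exprMn mulVf ?expr1n ?mul1r.
Qed.

End WordTrace.

(** * The commuting probability and the dimension measure *)

(** Burnside's orbit counting for conjugation. *)
Lemma card_commuting_pairs_Nirr (G : finGroupType) :
  #|commuting_pairs G| = (Nirr [set: G]%G * #|G|)%N.
Proof.
rewrite card_commuting_pairs NirrE -[#|G|]cardsT.
have acts : [acts [set: G]%G, on [set: G]%SET | conjg_action G]%act.
  by apply/actsP => x _ y; rewrite !inE.
have := Frobenius_Cauchy acts.
rewrite (_ : orbit (conjg_action G) [set: G]%SET @: [set: G]%SET = classes [set: G]%SET) //.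
move=> <-; rewrite (eq_bigl xpredT); last by move=> x; rewrite inE.
by apply: eq_bigr => z _; rewrite finset.setTI afixJ cent_set1.
Qed.

Section DimensionMeasure.
Variable R : realType.

(** The test function whose integral against the dimension measure counts the
    irreducible representations: it cancels the weight dim^2. *)
Definition inv_sqr_dim (x : Zplus_bar) : R :=
  if x is Some k then (sval k)%:R^-1 ^+ 2 else 0.

Lemma inv_sqr_dim_ge0 x : 0 <= inv_sqr_dim x.
Proof. by case: x => [k|] //=; rewrite sqr_ge0. Qed.

Lemma inv_sqr_dim_le1 x : inv_sqr_dim x <= 1.
Proof.
case: x => [[k k0]|] //=; rewrite exprn_ile1 ?invr_ge0 //.
by rewrite invf_le1 ?ltr0n // ler1n.
Qed.

Lemma continuous_inv_sqr_dim : continuous inv_sqr_dim.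
Proof.
case=> [k|].
  move=> U hU; have hk := nbhs_singleton hU.
  change (nbhs (k : Zplus) (Some @^-1` (inv_sqr_dim @^-1` U))).
  apply: (@filterS _ _ (nbhs_filter (k : Zplus)) [set k : Zplus]); last exact: discrete_set1.
  by move=> x /= ->.
apply/(@cvgrPdist_lt _ _ _ (nbhs (None : Zplus_bar)) (nbhs_filter _)) => e e0.
have [M hM] : exists M : nat, e^-1 < M%:R.
  by exists (Num.truncn e^-1).+1; apply: Num.Theory.truncnS_gt.
exists [set k : Zplus | (sval k <= M)%N].
  split; last exact: discrete_closed.
  apply: finite_compact.
  have : finite_set ((fun k : Zplus => sval k) @^-1` `I_M.+1).
    by apply: finite_preimage => //; move=> x y _ _; exact: val_inj.
  by apply: sub_finite_set => k /=; rewrite ltnS.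
move=> x [[k /= kM <-]|->] /=; rewrite sub0r normrN ?normr0 //.
rewrite ger0_norm ?sqr_ge0 //.
have kpos : 0 < (sval k)%:R :> R by rewrite ltr0n; case: (k).
apply: (@le_lt_trans _ _ (sval k)%:R^-1).
  rewrite expr2; apply: ler_piMl; first by rewrite invr_ge0.
  by rewrite invf_le1 // ler1n -(ltr0n R).
rewrite invf_plt ?posrE //; apply: lt_le_trans hM _.
by rewrite ler_nat ltnW // ltnNge; apply/negP.
Qed.

Lemma measurable_inv_sqr_dim :
  measurable_fun [set: borel Zplus_bar] (inv_sqr_dim : borel Zplus_bar -> R).
Proof.
apply: (@measurability _ _ (borel Zplus_bar) (measurableTypeR R) setT
  (inv_sqr_dim : borel Zplus_bar -> R) _ (RGenOInfty.measurableE R)) => _ [_ [x ->] <-].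
rewrite setTI; apply: sub_sigma_algebra.
by apply: open_comp; [move=> z _; exact: continuous_inv_sqr_dim | exact: interval_open].
Qed.

Lemma integral_mu_tilde (G : finGroupType) :
  \int[mu_tilde R G]_(x in [set: borel Zplus_bar]) inv_sqr_dim x =
  (Nirr [set: G]%G)%:R / #|G|%:R.
Proof.
have mf : measurable_fun [set: borel Zplus_bar]
    (fun x : borel Zplus_bar => (inv_sqr_dim x)%:E).
  by apply/measurable_EFinP; exact: measurable_inv_sqr_dim.
have f0 (x : borel Zplus_bar) : [set: borel Zplus_bar] x -> (0 <= (inv_sqr_dim x)%:E)%E.
  by move=> _; rewrite lee_fin inv_sqr_dim_ge0.
rewrite /Rintegral /mu_tilde ge0_integral_measure_series //.
have n0 : (#|G|%:R : R) != 0 by exact: cardG_neq0.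
under eq_eseriesr.
  move=> k _; rewrite ge0_integral_mscale // integral_dirac // diracT mul1e.
  rewrite -EFinM /mu_weight /=.
  have -> : k.+1%:R ^+ 2 / #|G|%:R * (num_irr_dim G k.+1)%:R * (k.+1%:R^-1 ^+ 2) =
     (num_irr_dim G k.+1)%:R / #|G|%:R :> R.
    have k0 : k.+1%:R != 0 :> R by rewrite pnatr_eq0.
    by move: k.+1%:R k0 => x x0; field; rewrite x0 n0.
  over.
pose dg (i : Iirr [set: G]%G) := irr_degree (socle_of_Iirr i).
pose M := \max_i dg i.
have big0 k : (M <= k)%N -> num_irr_dim G k.+1 = 0%N.
  move=> Mk; apply: eq_card0 => i; rewrite inE; apply: contraTF Mk => /eqP e.
  by rewrite -ltnNge -e; exact: (leq_bigmax (F := dg)).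
have sumN : (\sum_(0 <= k < M) num_irr_dim G k.+1)%N = Nirr [set: G]%G.
  rewrite (eq_bigr (fun k => \sum_(i : Iirr [set: G]%G) (dg i == k.+1))%N); last first.
    by move=> k _; rewrite /num_irr_dim -sum1_card big_mkcond.
  rewrite exchange_big /= -[RHS]card_ord -sum1_card; apply: eq_bigr => i _.
  have dpos : (0 < dg i)%N := irr_degree_gt0 _.
  have dM : ((dg i).-1 < M)%N by rewrite prednK //; exact: (leq_bigmax (F := dg)).
  rewrite (bigD1_seq (dg i).-1) ?mem_index_iota ?iota_uniq //= prednK // eqxx.
  rewrite big1 ?addn0 // => k; apply: contraNeq; rewrite eqb0 negbK => /eqP ->.
  by [].
have -> : (\sum_(0 <= k <oo) ((num_irr_dim G k.+1)%:R / #|G|%:R : R)%:E)%E =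
    ((Nirr [set: G]%G)%:R / #|G|%:R : R)%:E.
  apply/cvg_lim => //; apply: cvg_near_cst; exists M => // n /= Mn.
  rewrite (@big_cat_nat _ _ _ M) //= [X in (_ + X)%E]big1_seq ?adde0; last first.
    by move=> k; rewrite mem_index_iota => /andP[_ /andP[Mk _]]; rewrite big0 // mul0r.
  by rewrite sumEFin -mulr_suml -natr_sum sumN.
by [].
Qed.

Lemma integral_dirac_infty :
  \int[dirac_infty R]_(x in [set: borel Zplus_bar]) inv_sqr_dim x = 0.
Proof.
rewrite /Rintegral /dirac_infty integral_dirac // ?diracT ?mul1e //.
by apply/measurable_EFinP; exact: measurable_inv_sqr_dim.
Qed.

Theorem cvg_commuting_probability (G : nat -> finGroupType) :
  cvg_weakly (fun N => mu_tilde R (G N)) (dirac_infty R) ->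
  #|commuting_pairs (G N)|%:R / #|G N|%:R ^+ 2 @[N --> \oo] --> (0 : R).
Proof.
move=> h; have := h _ continuous_inv_sqr_dim.
rewrite integral_dirac_infty => cvg.
under eq_fun.
  move=> N; rewrite card_commuting_pairs_Nirr natrM expr2 invfM mulrA mulfK; last exact: cardG_neq0.
  rewrite -integral_mu_tilde; over.
apply: cvg; exists 1 => x; rewrite ger0_norm ?inv_sqr_dim_ge0 //.
exact: inv_sqr_dim_le1.
Qed.

End DimensionMeasure.

(** * The C*-algebra of bounded families of matrices *)

Section RealInnerProduct.
Variable R : realType.
Local Notation C := R[i].

(** The inner product of the complex plane as a real space. Norms only depend on
    the real part of the Hermitian product, so this is enough for operator
    bounds. *)
Definition cdot (z w : C) : R :=
  complex.Re z * complex.Re w + complex.Im z * complex.Im w.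

Lemma cdotC z w : cdot z w = cdot w z.
Proof. by rewrite /cdot mulrC [X in _ + X]mulrC. Qed.

Lemma cdotDr z w w' : cdot z (w + w') = cdot z w + cdot z w'.
Proof. by case: w w' => [a b] [a' b']; rewrite /cdot /=; ring. Qed.

Lemma cdot_conjl a z w : cdot (a * z) w = cdot z (Num.conj a * w).
Proof. by case: a z w => [a a'] [b b'] [c c']; rewrite /cdot /=; ring. Qed.

Lemma cdot_ge0 z : 0 <= cdot z z.
Proof. by rewrite addr_ge0 // -expr2 sqr_ge0. Qed.

Lemma cdot_eq0 z : cdot z z = 0 -> z = 0.
Proof.
case: z => a b; rewrite /cdot /= -!expr2 => /eqP.
by rewrite paddr_eq0 ?sqr_ge0 // !sqrf_eq0 => /andP[/eqP -> /eqP ->].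
Qed.

Lemma cdotZ k z w : cdot (k * z) (k * w) = cdot k k * cdot z w.
Proof. by case: k z w => [a a'] [b b'] [c c']; rewrite /cdot /=; ring. Qed.

Variable n : nat.
Implicit Types u v w : 'cV[C]_n.

Definition vdot u v : R := \sum_i cdot (u i 0) (v i 0).
Local Notation nsq v := (vdot v v).

Lemma vdotC u v : vdot u v = vdot v u.
Proof. by apply: eq_bigr => i _; rewrite cdotC. Qed.

Lemma vdotDr u v w : vdot u (v + w) = vdot u v + vdot u w.
Proof. by rewrite -big_split; apply: eq_bigr => i _; rewrite mxE cdotDr. Qed.

Lemma vdotDl u v w : vdot (u + v) w = vdot u w + vdot v w.
Proof. by rewrite vdotC vdotDr !(vdotC w). Qed.

Lemma vdot_ge0 v : 0 <= nsq v.
Proof. by apply: sumr_ge0 => i _; exact: cdot_ge0. Qed.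

Lemma vdot0_entry v i : nsq v = 0 -> v i 0 = 0.
Proof.
move=> /eqP; rewrite psumr_eq0 => [/allP h|j _]; last exact: cdot_ge0.
by apply: cdot_eq0; apply/eqP; apply: (h i); rewrite mem_index_enum.
Qed.

Lemma vdot_eq0 v : nsq v = 0 -> v = 0.
Proof. by move=> h; apply/colP => i; rewrite (vdot0_entry i h) mxE. Qed.

Lemma vdotZ k u v : vdot (k *: u) (k *: v) = cdot k k * vdot u v.
Proof. by rewrite mulr_sumr; apply: eq_bigr => i _; rewrite !mxE cdotZ. Qed.

Lemma cdotRl (x : R) (z w : C) : cdot (x%:C * z) w = x * cdot z w.
Proof. by case: z w => [b b'] [c c']; rewrite /cdot /=; ring. Qed.

Lemma vdotRl (x : R) u v : vdot (x%:C *: u) v = x * vdot u v.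
Proof. by rewrite mulr_sumr; apply: eq_bigr => i _; rewrite !mxE cdotRl. Qed.

(** Expand the square norm of |v|^2 u - <u, v> v. *)
Lemma vdot_CauchySchwarz u v : vdot u v ^+ 2 <= nsq u * nsq v.
Proof.
have [v0|v0] := eqVneq (nsq v) 0.
  rewrite (vdot_eq0 v0) (_ : vdot u 0 = 0) ?expr0n ?mulr_ge0 ?vdot_ge0 //.
  by rewrite /vdot big1 // => i _; rewrite mxE /cdot /= !mulr0 addr0.
have vpos : 0 < nsq v by rewrite lt0r v0 vdot_ge0.
pose t := nsq v; pose s := vdot u v.
have := vdot_ge0 (t%:C *: u + (- s)%:C *: v).
rewrite !(vdotDr, vdotDl) !vdotRl !(vdotC _ (_ *: _)) !vdotRl (vdotC v u) -/t -/s => h.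
have : 0 <= t * (t * nsq u - s ^+ 2) by move: h; congr (0 <= _); ring.
by rewrite pmulr_rge0 // subr_ge0 mulrC.
Qed.

Definition adj_mx (a : 'M[C]_n) : 'M[C]_n := map_mx Num.conj a^T.

Lemma adj_mxK a : adj_mx (adj_mx a) = a.
Proof. by apply/matrixP => i j; rewrite !mxE conjCK. Qed.

Lemma adj_mxD a b : adj_mx (a + b) = adj_mx a + adj_mx b.
Proof. by apply/matrixP => i j; rewrite !mxE rmorphD. Qed.

Lemma adj_mxZ k a : adj_mx (k *: a) = Num.conj k *: adj_mx a.
Proof. by apply/matrixP => i j; rewrite !mxE rmorphM. Qed.

Lemma adj_mxM a b : adj_mx (a *m b) = adj_mx b *m adj_mx a.
Proof. by rewrite /adj_mx trmx_mul map_mxM. Qed.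

Lemma vdot_adj a u v : vdot (a *m u) v = vdot u (adj_mx a *m v).
Proof.
rewrite /vdot.
have cdot_suml (I : finType) (F : I -> C) (w : C) : cdot (\sum_i F i) w = \sum_i cdot (F i) w.
  rewrite /cdot (raddf_sum (@complex.Re R : {additive _ -> _})) (raddf_sum (@complex.Im R : {additive _ -> _})).
  by rewrite !mulr_suml -big_split.
transitivity (\sum_i \sum_j cdot (a i j * u j 0) (v i 0)).
  by apply: eq_bigr => i _; rewrite mxE cdot_suml.
rewrite exchange_big /=; apply: eq_bigr => j _.
rewrite mxE cdotC cdot_suml; apply: eq_bigr => i _.
by rewrite cdot_conjl cdotC !mxE.
Qed.

Definition opbound (a : 'M[C]_n) (c : R) := forall v, nsq (a *m v) <= c ^+ 2 * nsq v.

Lemma opboundW a c c' : 0 <= c -> c <= c' -> opbound a c -> opbound a c'.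
Proof.
move=> c0 cc' h v; apply: le_trans (h v) _; apply: ler_wpM2r; first exact: vdot_ge0.
by rewrite ler_pXn2r // nnegrE // (le_trans c0).
Qed.

Lemma le_of_sqr_le u v c : 0 <= c -> vdot u v ^+ 2 <= c ^+ 2 -> vdot u v <= c.
Proof.
move=> c0 h; rewrite (le_trans (ler_norm _)) // -ler_sqr ?nnegrE //.
by rewrite real_normK ?num_real.
Qed.

Lemma opboundD a b c d : 0 <= c -> 0 <= d -> opbound a c -> opbound b d ->
  opbound (a + b) (c + d).
Proof.
move=> c0 d0 ha hb v; rewrite mulmxDl !(vdotDl, vdotDr) (vdotC (b *m v)).
have h : vdot (a *m v) (b *m v) <= c * d * nsq v.
  apply: le_of_sqr_le; first by rewrite !mulr_ge0 ?vdot_ge0.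
  apply: le_trans (vdot_CauchySchwarz _ _) _.
  have -> : (c * d * nsq v) ^+ 2 = (c ^+ 2 * nsq v) * (d ^+ 2 * nsq v) by ring.
  by apply: ler_pM; rewrite ?vdot_ge0.
have := ha v; have := hb v => h1 h2.
have -> : (c + d) ^+ 2 * nsq v = c ^+ 2 * nsq v + c * d * nsq v + (c * d * nsq v + d ^+ 2 * nsq v) by ring.
by apply: lerD; apply: lerD.
Qed.

Lemma opboundM a b c d : opbound a c -> opbound b d -> opbound (a *m b) (c * d).
Proof.
move=> ha hb v; rewrite -mulmxA exprMn -mulrA.
apply: le_trans (ha _) _; apply: ler_wpM2l; first exact: sqr_ge0.
exact: hb.
Qed.

Lemma opbound1 : opbound 1%:M 1.
Proof. by move=> v; rewrite mul1mx expr1n mul1r. Qed.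

Lemma opboundZ k a c s : s ^+ 2 = cdot k k -> opbound a c -> opbound (k *: a) (s * c).
Proof.
move=> hs ha v; rewrite -scalemxAl vdotZ exprMn hs -mulrA.
by apply: ler_wpM2l; [exact: cdot_ge0 | exact: ha].
Qed.

(** For t = |a* v|^2 = <a a* v, v>, Cauchy-Schwarz gives t^2 <= c^2 t |v|^2. *)
Lemma opbound_adj a c : opbound a c -> opbound (adj_mx a) c.
Proof.
move=> ha v; set t := vdot _ _.
have [t0|t0] := eqVneq t 0; first by rewrite t0 mulr_ge0 ?sqr_ge0 ?vdot_ge0.
have tpos : 0 < t by rewrite lt0r t0 vdot_ge0.
rewrite -(ler_pM2l tpos) -expr2.
have -> : t = vdot (a *m (adj_mx a *m v)) v by rewrite vdot_adj.
apply: le_trans (vdot_CauchySchwarz _ _) _.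
rewrite mulrA; apply: ler_wpM2r; first exact: vdot_ge0.
by apply: le_trans (ha _) _; rewrite [leRHS]mulrC (vdot_adj a _ v).
Qed.

(** |a v|^2 = <v, a* a v>, which Cauchy-Schwarz bounds by c |v|^2. *)
Lemma opbound_cstar a c : 0 <= c -> opbound (adj_mx a *m a) c ->
  opbound a (Num.sqrt c).
Proof.
move=> c0 h v; rewrite sqr_sqrtr // vdot_adj.
apply: le_of_sqr_le; first by rewrite mulr_ge0 ?vdot_ge0.
apply: le_trans (vdot_CauchySchwarz _ _) _.
have -> : (c * nsq v) ^+ 2 = nsq v * (c ^+ 2 * nsq v) by ring.
by rewrite mulmxA; apply: ler_wpM2l; [exact: vdot_ge0 | exact: h].
Qed.

Lemma opbound_entry a c i j : 0 <= c -> opbound a c -> cdot (a i j) (a i j) <= c ^+ 2.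
Proof.
move=> c0 h.
have := h (delta_mx j 0).
have -> : nsq (delta_mx j 0) = 1.
  rewrite /vdot (bigD1 j) //= big1 => [|k kj]; rewrite mxE ?eqxx /cdot /= ?(negPf kj) ?mulr0 ?addr0 ?mulr1 //.
rewrite mulr1; apply: le_trans.
rewrite /vdot (bigD1 i) //= -colE mxE lerDl.
by apply: sumr_ge0 => k _; exact: cdot_ge0.
Qed.

End RealInnerProduct.

Lemma cvg_rsum (R : realType) (I : finType) (f : I -> nat -> R) (l : I -> R) :
  (forall i, f i q @[q --> \oo] --> l i) ->
  \sum_i f i q @[q --> \oo] --> \sum_i l i.
Proof.
move=> h; elim: (index_enum I) => [|i r IH].
  by rewrite big_nil; under eq_fun do rewrite big_nil; exact: cvg_cst.
by rewrite big_cons; under eq_fun do rewrite big_cons; apply: cvgD.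
Qed.

Lemma ReM_sub (R : realType) (a b a' b' : R) (z : R[i]) :
  complex.Re ((a +i* b - z) * (a' +i* b')) =
  (a - complex.Re z) * a' - (b - complex.Im z) * b'.
Proof. by case: z. Qed.

Lemma ImM_sub (R : realType) (a b a' b' : R) (z : R[i]) :
  complex.Im ((a +i* b - z) * (a' +i* b')) =
  (a - complex.Re z) * b' + (b - complex.Im z) * a'.
Proof. by case: z. Qed.

Section BoundedFamilies.
Variables (R : realType) (n : nat -> nat).
Local Notation C := R[i].

Definition fam_bound (a : forall D, 'M[C]_(n D)) (c : R) :=
  0 <= c /\ forall D, opbound (a D) c.

(** The distinguished index [e] is a parameter of the type: it makes every
    dimension positive, so that the ring of families is nontrivial, and it selects
    the vector of [vector_state]. *)
Record bounded_family (e : forall D, 'I_(n D)) := BoundedFamily {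
  fam :> forall D, 'M[C]_(n D);
  famP : exists c, fam_bound fam c }.

Variable e : forall D, 'I_(n D).
Local Notation A := (bounded_family e).

HB.instance Definition _ := gen_eqMixin A.
HB.instance Definition _ := gen_choiceMixin A.

Lemma famE (a b : A) : (forall D, a D = b D) -> a = b.
Proof.
case: a b => [a ha] [b hb] /= h; have ab : a = b by exact: functional_extensionality_dep.
by move: hb {h}; rewrite -ab => hb; congr BoundedFamily; exact: Prop_irrelevance.
Qed.

Lemma fam_bound0 : exists c, fam_bound (fun D => 0) c.
Proof.
exists 0; split=> // D v; rewrite mul0mx expr0n mul0r /vdot big1 // => i _.
by rewrite mxE /cdot /= !mulr0 addr0.
Qed.

Lemma fam_bound1 : exists c, fam_bound (fun D => 1%:M) c.
Proof. by exists 1; split=> // D; exact: opbound1. Qed.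

Lemma fam_boundD (a b : A) : exists c, fam_bound (fun D => a D + b D) c.
Proof.
case: (famP a) (famP b) => c [c0 hc] [d [d0 hd]].
by exists (c + d); split; [exact: addr_ge0 | move=> D; exact: opboundD].
Qed.

Lemma fam_boundM (a b : A) : exists c, fam_bound (fun D => a D *m b D) c.
Proof.
case: (famP a) (famP b) => c [c0 hc] [d [d0 hd]].
by exists (c * d); split; [exact: mulr_ge0 | move=> D; exact: opboundM].
Qed.

Lemma fam_boundZ k (a : A) : exists c, fam_bound (fun D => k *: a D) c.
Proof.
case: (famP a) => c [c0 hc]; exists (Num.sqrt (cdot k k) * c); split.
  by rewrite mulr_ge0 ?sqrtr_ge0.
by move=> D; apply: opboundZ => //; rewrite sqr_sqrtr ?cdot_ge0.
Qed.

Lemma fam_boundN (a : A) : exists c, fam_bound (fun D => - a D) c.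
Proof.
case: (fam_boundZ (-1) a) => c [c0 hc]; exists c; split=> // D.
by rewrite -scaleN1r; exact: hc.
Qed.

Lemma fam_bound_adj (a : A) : exists c, fam_bound (fun D => adj_mx (a D)) c.
Proof. by case: (famP a) => c [c0 hc]; exists c; split=> // D; exact: opbound_adj. Qed.

Definition bf0 : A := @BoundedFamily e _ fam_bound0.
Definition bf1 : A := @BoundedFamily e _ fam_bound1.
Definition bfD (a b : A) : A := @BoundedFamily e _ (fam_boundD a b).
Definition bfM (a b : A) : A := @BoundedFamily e _ (fam_boundM a b).
Definition bfZ k (a : A) : A := @BoundedFamily e _ (fam_boundZ k a).
Definition bfN (a : A) : A := @BoundedFamily e _ (fam_boundN a).
Definition bf_adj (a : A) : A := @BoundedFamily e _ (fam_bound_adj a).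

Lemma bfDA : associative bfD.
Proof. by move=> a b c; apply: famE => D; rewrite /= addrA. Qed.
Lemma bfDC : commutative bfD.
Proof. by move=> a b; apply: famE => D; rewrite /= addrC. Qed.
Lemma bfD0 : left_id bf0 bfD.
Proof. by move=> a; apply: famE => D; rewrite /= add0r. Qed.
Lemma bfDN : left_inverse bf0 bfN bfD.
Proof. by move=> a; apply: famE => D; rewrite /= addNr. Qed.
HB.instance Definition _ := GRing.isZmodule.Build A bfDA bfDC bfD0 bfDN.

Lemma bfMA : associative bfM.
Proof. by move=> a b c; apply: famE => D; rewrite /= mulmxA. Qed.
Lemma bf1M : left_id bf1 bfM.
Proof. by move=> a; apply: famE => D; rewrite /= mul1mx. Qed.
Lemma bfM1 : right_id bf1 bfM.
Proof. by move=> a; apply: famE => D; rewrite /= mulmx1. Qed.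
Lemma bfMDl : left_distributive bfM bfD.
Proof. by move=> a b c; apply: famE => D; rewrite /= mulmxDl. Qed.
Lemma bfMDr : right_distributive bfM bfD.
Proof. by move=> a b c; apply: famE => D; rewrite /= mulmxDr. Qed.
Lemma bf1_neq0 : bf1 != bf0.
Proof.
apply/eqP => h; have := congr1 (fun a : A => a 0%N (e 0) (e 0)) h.
by rewrite /= !mxE eqxx => /eqP; rewrite oner_eq0.
Qed.
HB.instance Definition _ := GRing.Zmodule_isNzRing.Build A
  bfMA bf1M bfM1 bfMDl bfMDr bf1_neq0.

Lemma bfZA (k l : C) (a : A) : bfZ k (bfZ l a) = bfZ (k * l) a.
Proof. by apply: famE => D; rewrite /= scalerA. Qed.
Lemma bf1Z : left_id 1 bfZ.
Proof. by move=> a; apply: famE => D; rewrite /= scale1r. Qed.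
Lemma bfZDr : right_distributive bfZ +%R.
Proof. by move=> k a b; apply: famE => D; rewrite /= scalerDr. Qed.
Lemma bfZDl (a : A) : {morph bfZ^~ a : k l / k + l}.
Proof. by move=> k l; apply: famE => D; rewrite /= scalerDl. Qed.
HB.instance Definition _ := GRing.Zmodule_isLmodule.Build C A bfZA bf1Z bfZDr bfZDl.

Lemma bfZAl (k : C) (a b : A) : k *: (a * b) = (k *: a) * b.
Proof. by apply: famE => D; rewrite /= scalemxAl. Qed.
HB.instance Definition _ := GRing.Lmodule_isLalgebra.Build C A bfZAl.

Lemma bfZAr (k : C) (a b : A) : k *: (a * b) = a * (k *: b).
Proof. by apply: famE => D; rewrite /= scalemxAr. Qed.
HB.instance Definition _ := GRing.Lalgebra_isAlgebra.Build C A bfZAr.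

(** The supremum of the operator norms, as the least common bound. *)
Definition bnorm (a : A) : R := inf [set c | fam_bound a c].

Lemma bnorm_ge0 a : 0 <= bnorm a.
Proof. by apply: lb_le_inf; [exact: famP | move=> c []]. Qed.

Lemma bnorm_le (a : A) c : fam_bound a c -> bnorm a <= c.
Proof. by move=> h; apply: ge_inf => //; exists 0 => d []. Qed.

(** The infimum is attained: |a v| / |v| is below every bound, hence below the
    infimum. *)
Lemma bnormP (a : A) : fam_bound a (bnorm a).
Proof.
split; first exact: bnorm_ge0.
move=> D v; have [v0|v0] := eqVneq (vdot v v) 0.
  by rewrite (vdot_eq0 v0) mulmx0 /vdot big1 ?mulr0 // => i _; rewrite mxE /cdot /= !mulr0 addr0.
have vpos : 0 < vdot v v by rewrite lt0r v0 vdot_ge0.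
set t := vdot (_ *m _) _.
have t0 : 0 <= t by exact: vdot_ge0.
rewrite -ler_pdivrMr //.
have : Num.sqrt (t / vdot v v) <= bnorm a.
  apply: lb_le_inf; first exact: famP.
  move=> c [c0 hc]; rewrite -(ler_pXn2r (n := 2)) ?nnegrE ?sqrtr_ge0 //.
  by rewrite sqr_sqrtr ?divr_ge0 ?vdot_ge0 // ler_pdivrMr //; exact: hc.
move=> h; rewrite -[leLHS]sqr_sqrtr ?divr_ge0 ?vdot_ge0 //.
by rewrite ler_pXn2r ?nnegrE ?sqrtr_ge0 ?bnorm_ge0.
Qed.

Lemma bf_adjK (a : A) : bf_adj (bf_adj a) = a.
Proof. by apply: famE => D; exact: adj_mxK. Qed.
Lemma bf_adjD (a b : A) : bf_adj (a + b) = bf_adj a + bf_adj b.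
Proof. by apply: famE => D; exact: adj_mxD. Qed.
Lemma bf_adjZ (k : C) (a : A) : bf_adj (k *: a) = Num.conj k *: bf_adj a.
Proof. by apply: famE => D; exact: adj_mxZ. Qed.
Lemma bf_adjM (a b : A) : bf_adj (a * b) = bf_adj b * bf_adj a.
Proof. by apply: famE => D; exact: adj_mxM. Qed.

Lemma fam_bound_entry (a : A) c D i j : fam_bound a c ->
  cdot (a D i j) (a D i j) <= c ^+ 2.
Proof. by case=> c0 /(_ D) h; exact: opbound_entry. Qed.

Lemma bnorm0_eq0 (a : A) : bnorm a = 0 -> a = 0.
Proof.
move=> a0; have h := bnormP a; rewrite a0 in h.
apply: famE => D; apply/matrixP => i j; rewrite mxE; apply: cdot_eq0.
apply/le_anti; rewrite cdot_ge0 andbT.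
by have := fam_bound_entry i j h; rewrite expr0n.
Qed.

Lemma bnormD_le (a b : A) : bnorm (a + b) <= bnorm a + bnorm b.
Proof.
have [a0 ha] := bnormP a; have [b0 hb] := bnormP b.
apply: bnorm_le; split; first exact: addr_ge0.
by move=> D; exact: opboundD.
Qed.

Lemma bnormM_le (a b : A) : bnorm (a * b) <= bnorm a * bnorm b.
Proof.
have [a0 ha] := bnormP a; have [b0 hb] := bnormP b.
apply: bnorm_le; split; first exact: mulr_ge0.
by move=> D; apply: opboundM; [exact: ha | exact: hb].
Qed.

Lemma Re_norm (k : C) : complex.Re `|k| = Num.sqrt (cdot k k).
Proof. by case: k => x y; rewrite /cdot -!expr2. Qed.

Lemma bnormZ_le (k : C) (a : A) : bnorm (k *: a) <= complex.Re `|k| * bnorm a.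
Proof.
have [a0 ha] := bnormP a; rewrite Re_norm.
apply: bnorm_le; split; first by rewrite mulr_ge0 ?sqrtr_ge0.
by move=> D; apply: opboundZ; [rewrite sqr_sqrtr ?cdot_ge0 | exact: ha].
Qed.

Lemma bnormZ (k : C) (a : A) : bnorm (k *: a) = complex.Re `|k| * bnorm a.
Proof.
apply/le_anti; rewrite bnormZ_le andTb.
have [->|k0] := eqVneq k 0; first by rewrite Re_norm /cdot /= !mulr0 addr0 sqrtr0 mul0r bnorm_ge0.
have kk : complex.Re `|k^-1| * complex.Re `|k| = 1.
  rewrite !Re_norm -sqrtrM ?cdot_ge0 //.
  rewrite -{1}[k^-1]mulr1 -{2}[k^-1]mulr1 cdotZ /cdot /= !mulr0 !addr0 !mul1r.
  have := cdotZ k^-1 k k; rewrite mulVf // {1}/cdot /= mulr1 mulr0 addr0 => h.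
  by rewrite -[RHS]sqrtr1 mulr1 -h.
have k1 : 0 <= complex.Re `|k| by rewrite Re_norm sqrtr_ge0.
have := bnormZ_le k^-1 (k *: a); rewrite scalerA mulVf // scale1r => h.
apply: le_trans (ler_wpM2l k1 h) _.
by rewrite mulrA [_ * complex.Re _]mulrC kk mul1r.
Qed.

Lemma bnorm_adjM (a : A) : bnorm (bf_adj a * a) = bnorm a ^+ 2.
Proof.
have [a0 ha] := bnormP a; apply/le_anti/andP; split.
  apply: bnorm_le; split; first exact: sqr_ge0.
  by move=> D; apply: opboundM; [apply: opbound_adj; exact: ha | exact: ha].
have [b0 hb] := bnormP (bf_adj a * a).
rewrite -[leRHS](sqr_sqrtr b0) ler_pXn2r ?nnegrE ?sqrtr_ge0 //.
apply: bnorm_le; split; first exact: sqrtr_ge0.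
by move=> D; apply: opbound_cstar => //; exact: hb.
Qed.

(** The limit is taken entrywise; the bound on u_p - u_q passes to the limit in q
    because each vector has finitely many coordinates. *)
Lemma bnorm_complete (u : nat -> A) :
  (forall eps, 0 < eps -> exists N, forall p q,
      (N <= p)%N -> (N <= q)%N -> bnorm (u p - u q) < eps) ->
  exists x : A, bnorm (u p - x) @[p --> \oo] --> 0.
Proof.
move=> cau.
pose entry_part (t : bool) D i j p : R := re_im (fun p => u p D i j) t p.
have ent_cvg t D i j : cvg (entry_part t D i j p @[p --> \oo]).
  apply: cauchy_cvg; apply: cauchy_exP => eps eps0.
  have [N hN] := cau eps eps0; exists (entry_part t D i j N); exists N => // p /= Np.
  have := hN _ _ (leqnn N) Np => hlt.
  have hb := fam_bound_entry i j (bnormP (u N - u p)).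
  rewrite /ball /=; apply: le_lt_trans hlt.
  rewrite -(ler_pXn2r (n := 2)) ?nnegrE ?normr_ge0 ?bnorm_ge0 //.
  rewrite real_normK ?num_real //; apply: le_trans hb.
  rewrite !mxE /entry_part /re_im; case: (u N D i j) (u p D i j) => [x y] [x' y'].
  by rewrite /cdot -!expr2; case: (t) => /=; rewrite ?lerDl ?lerDr sqr_ge0.
pose x D : 'M[C]_(n D) := \matrix_(i, j)
  Complex (lim (entry_part false D i j p @[p --> \oo])) (lim (entry_part true D i j p @[p --> \oo])).
have diff eps : 0 < eps -> exists N, forall p, (N <= p)%N ->
    fam_bound (fun D => u p D - x D) eps.
  move=> eps0; have [N hN] := cau eps eps0; exists N => p Np; split; first exact: ltW.
  move=> D v.
  pose mv (q : nat) i : C := \sum_j (u p D i j - u q D i j) * v j 0.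
  have hmv q : (N <= q)%N -> \sum_i cdot (mv q i) (mv q i) <= eps ^+ 2 * vdot v v.
    move=> Nq; have [b0 hb] := bnormP (u p - u q).
    have := opboundW b0 (ltW (hN _ _ Np Nq)) (hb D) v; apply: le_trans.
    rewrite le_eqVlt; apply/orP; left; apply/eqP; apply: eq_bigr => i _.
    by congr cdot; rewrite mxE; apply: eq_bigr => j _; rewrite !mxE.
  pose mx i : C := \sum_j (u p D i j - x D i j) * v j 0.
  have cmv i : cdot (mv q i) (mv q i) @[q --> \oo] --> cdot (mx i) (mx i).
    have cRe : complex.Re (mv q i) @[q --> \oo] --> complex.Re (mx i).
      rewrite /mx /mv raddf_sum; under eq_fun do rewrite raddf_sum.
      apply: cvg_rsum => j; rewrite mxE.
      have c1 := ent_cvg false D i j; have c2 := ent_cvg true D i j.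
      case: (u p D i j) (v j 0) => [a b] [a' b'] /=.
      under eq_fun do rewrite ReM_sub.
      by apply: cvgB; apply: cvgM; try exact: cvg_cst; apply: cvgB; try exact: cvg_cst.
    have cIm : complex.Im (mv q i) @[q --> \oo] --> complex.Im (mx i).
      rewrite /mx /mv raddf_sum; under eq_fun do rewrite raddf_sum.
      apply: cvg_rsum => j; rewrite mxE.
      have c1 := ent_cvg false D i j; have c2 := ent_cvg true D i j.
      case: (u p D i j) (v j 0) => [a b] [a' b'] /=.
      under eq_fun do rewrite ImM_sub.
      by apply: cvgD; apply: cvgM; try exact: cvg_cst; apply: cvgB; try exact: cvg_cst.
    by apply: cvgD; apply: cvgM.
  have -> : vdot ((u p D - x D) *m v) ((u p D - x D) *m v) = \sum_i cdot (mx i) (mx i).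
    by apply: eq_bigr => i _; congr cdot; rewrite mxE; apply: eq_bigr => j _; rewrite !mxE.
  apply: (cvgr_to_le (cvg_rsum (fun i => cmv i))).
  by exists N => // q /= Nq; exact: hmv.
have xb : exists c, fam_bound x c.
  have [N hN] := diff 1 ltr01.
  have [c hc] := famP (u N - @BoundedFamily e _ (ex_intro _ 1 (hN N (leqnn N)))).
  exists c; case: hc => c0 hc; split=> // D.
  by have := hc D; rewrite /= opprB addrC subrK.
exists (@BoundedFamily e _ xb).
apply/cvgrPdist_le => eps eps0; have [N hN] := diff eps eps0.
exists N => // p /= Np; rewrite sub0r normrN ger0_norm ?bnorm_ge0 //.
apply: (@bnorm_le (u p - @BoundedFamily e _ xb)); exact: hN p Np.
Qed.

HB.instance Definition _ := isCStarAlgebra.Build R A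
  bf_adjK bf_adjD bf_adjZ bf_adjM bnorm0_eq0 bnormD_le bnormZ bnormM_le bnorm_adjM bnorm_complete.

End BoundedFamilies.

(** * Limits of vector states along an ultrafilter *)

Section UltraLimit.
Variable R : realType.

(** A free ultrafilter, along which every bounded sequence converges. *)
Definition nat_ultra : set_system nat := sval (cid (ultraFilterLemma (F := \oo) _)).

Lemma nat_ultraP : UltraFilter nat_ultra /\ \oo `<=` nat_ultra.
Proof. by rewrite /nat_ultra; case: cid. Qed.

Instance nat_ultra_proper : ProperFilter nat_ultra.
Proof. by have [[]] := nat_ultraP. Qed.

Definition ulim (f : nat -> R) : R := lim (f D @[D --> nat_ultra]).

Lemma ulim_cvg (f : nat -> R) M : (forall D, `|f D| <= M) ->
  f D @[D --> nat_ultra] --> ulim f.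
Proof.
move=> fM; have := @segment_compact R (- M) M; rewrite compact_ultra.
have U : UltraFilter (f D @[D --> nat_ultra]).
  split; first exact: fmap_proper_filter.
  move=> H PH /= sH; apply/seteqP; split => // A HA.
  have [UU _] := nat_ultraP.
  have [//|/= nA] := in_ultra_setVsetC (f @^-1` A) UU.
  have HnA : H (~` A) := sH (~` A) nA.
  have [x []] := filter_ex (filterI HA HnA).
  by [].
move=> /(_ _ U) [|l [_ hl]]; last by apply/cvg_ex; exists l.
apply: (@filterS _ nat_ultra _ setT) => [D _ /=|]; last exact: filterT.
rewrite in_itv /= -ler_norml; exact: fM.
Qed.

(** Freeness of the ultrafilter: only the tail of the sequence matters. *)
Lemma ulim_near (f : nat -> R) l d : (forall D, (d <= D)%N -> f D = l) -> ulim f = l.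
Proof.
move=> h; apply/cvg_lim => //; apply: cvg_near_cst.
by have [_ sub] := nat_ultraP; apply: sub; exists d.
Qed.

Lemma ulimD (f g : nat -> R) M M' :
  (forall D, `|f D| <= M) -> (forall D, `|g D| <= M') ->
  ulim (fun D => f D + g D) = ulim f + ulim g.
Proof.
by move=> /ulim_cvg hf /ulim_cvg hg; apply/cvg_lim => //; exact: cvgD.
Qed.

Lemma ulimZ (f : nat -> R) M k : (forall D, `|f D| <= M) ->
  ulim (fun D => k * f D) = k * ulim f.
Proof. by move=> /ulim_cvg hf; apply/cvg_lim => //; exact: cvgMr. Qed.

Lemma ulim_ge0 (f : nat -> R) M : (forall D, `|f D| <= M) -> (forall D, 0 <= f D) ->
  0 <= ulim f.
Proof.
move=> /ulim_cvg hf f0; apply: (cvgr_to_ge hf); exact: filterE.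
Qed.

End UltraLimit.

Section VectorState.
Variables (R : realType) (n : nat -> nat) (e : forall D, 'I_(n D)).
Local Notation C := R[i].
Local Notation A := (@bounded_family R n e).
Implicit Types a b : A.

Definition corner (t : bool) a (D : nat) : R := re_im (fun D => a D (e D) (e D)) t D.

Lemma corner_bound t a D : `|corner t a D| <= bnorm a.
Proof.
have h := fam_bound_entry (e D) (e D) (bnormP a).
rewrite -(ler_pXn2r (n := 2)) ?nnegrE ?normr_ge0 ?bnorm_ge0 //.
rewrite real_normK ?num_real //; apply: le_trans h.
by rewrite /corner /re_im /cdot -!expr2; case: t; rewrite ?lerDl ?lerDr sqr_ge0.
Qed.

(** The limit of the vector states at the distinguished indices; real and
    imaginary parts are treated apart to use compactness of real segments. *)
Definition vector_state a : C :=
  Complex (ulim (corner false a)) (ulim (corner true a)).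

Lemma vector_state_linear : scalar vector_state.
Proof.
move=> k a b; case: k => x y; rewrite /vector_state.
have c1 := corner_bound false; have c2 := corner_bound true.
have cZ z t a' : forall D, `|z * corner t a' D| <= `|z| * bnorm a'.
  by move=> D; rewrite normrM; apply: ler_wpM2l => //; exact: corner_bound.
have E0 : corner false ((x +i* y) *: a + b) =
    (fun D => (x * corner false a D + (- y) * corner true a D) + corner false b D).
  apply/funext => D; rewrite /corner /re_im !mxE.
  by case: (a D _ _) (b D _ _) => [p q] [p' q'] /=; rewrite mulNr.
have E1 : corner true ((x +i* y) *: a + b) =
    (fun D => (x * corner true a D + y * corner false a D) + corner true b D).
  apply/funext => D; rewrite /corner /re_im !mxE.
  by case: (a D _ _) (b D _ _) => [p q] [p' q'] /=.
have cD z z' t t' : forall D, `|z * corner t a D + z' * corner t' a D| <=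
    `|z| * bnorm a + `|z'| * bnorm a.
  by move=> D; apply: le_trans (ler_normD _ _) _; apply: lerD.
rewrite E0 E1 (ulimD (cD _ _ _ _) (c1 b)) (ulimD (cD _ _ _ _) (c2 b)).
rewrite !(ulimD (cZ _ _ _) (cZ _ _ _)) !(ulimZ _ (c1 a)) !(ulimZ _ (c2 a)).
by apply/eqP; rewrite eq_complex /= mulNr !eqxx.
Qed.

HB.instance Definition _ := GRing.isLinear.Build C A C *%R vector_state vector_state_linear.

Lemma vector_state_near a z d :
  (forall D, (d <= D)%N -> a D (e D) (e D) = z) -> vector_state a = z.
Proof.
move=> h; rewrite /vector_state (@ulim_near _ _ (complex.Re z) d); last first.
  by move=> D dD; rewrite /corner /re_im h.
rewrite (@ulim_near _ _ (complex.Im z) d); last by move=> D dD; rewrite /corner /re_im h.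
by case: z {h}.
Qed.

Lemma vector_state_is_state : is_state (vector_state : {scalar A}).
Proof.
split; first by apply: (@vector_state_near _ _ 0) => D _; rewrite mxE eqxx.
move=> a.
have H D : (adj a * a) D (e D) (e D) = (\sum_k cdot (a D k (e D)) (a D k (e D)))%:C.
  rewrite mxE rmorph_sum; apply: eq_bigr => k _; rewrite !mxE.
  by case: (a D k (e D)) => p q; apply/eqP; rewrite eq_complex /cdot /=; apply/andP; split; apply/eqP; ring.
rewrite lecE /= /vector_state /=.
have -> : corner true (adj a * a) = (fun=> 0) by apply/funext => D; rewrite /corner /re_im H.
rewrite (@ulim_near _ _ 0 0) // eqxx /=.
apply: (ulim_ge0 (corner_bound false (adj a * a))) => D.
by rewrite /corner /re_im H /=; apply: sumr_ge0 => k _; exact: cdot_ge0.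
Qed.

End VectorState.
Arguments vector_state {R n e} a.

(** * Semicircular elements on truncated Fock spaces *)

(** Such a matrix moves coordinates of the vector to distinct places and deletes
    the others. *)
Lemma opbound_partial_injection (R : realType) (n : nat) (Q : rel 'I_n) :
  (forall i j j', Q i j -> Q i j' -> j = j') ->
  (forall i i' j, Q i j -> Q i' j -> i = i') ->
  opbound (\matrix_(i, j) (Q i j)%:R : 'M[R[i]]_n) 1.
Proof.
move=> Qr Qc v; rewrite expr1n mul1r.
apply: (@le_trans _ _ (\sum_i \sum_j (Q i j)%:R * cdot (v j 0) (v j 0))).
  apply: ler_sum => i _; rewrite mxE.
  have [[j Qij]|noQ] := pselect (exists j, Q i j).
    rewrite (bigD1 j) //= [leRHS](bigD1 j) //= !mxE Qij !mul1r.
    have Q0 j' : j' != j -> Q i j' = false.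
      by apply: contraNF => Qij'; apply/eqP; exact: Qr Qij' Qij.
    rewrite !big1 ?addr0 // => j' jj'; rewrite ?mxE Q0 // ?mul0r //.
  have Q0 j : Q i j = false by apply/negP => h; apply: noQ; exists j.
  rewrite !big1 // => [|j _|j _]; rewrite ?mxE ?Q0 ?mul0r // /cdot /= ?mulr0 ?addr0 //.
rewrite exchange_big /=; apply: ler_sum => j _.
rewrite -mulr_suml -[leRHS]mul1r; apply: ler_wpM2r; first exact: cdot_ge0.
have [[i Qij]|noQ] := pselect (exists i, Q i j); last first.
  by rewrite big1 // => i _; rewrite (_ : Q i j = false) //; apply/negP => h; apply: noQ; exists i.
rewrite (bigD1 i) //= big1 ?addr0 ?Qij // => i' ii'.
rewrite (_ : Q i' j = false) //; apply/negP => h.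
by move/eqP: ii'; apply; exact: Qc h Qij.
Qed.

Section Fock.
Variables (R : realType) (Y : finType).
Local Notation C := R[i].

Definition fock_dim D := #|{: D.-bseq Y}|.
Definition vacuum D : 'I_(fock_dim D) := enum_rank [bseq].
Local Notation A := (@bounded_family R fock_dim vacuum).

Definition word_of D (i : 'I_(fock_dim D)) : seq Y := bseqval (enum_val i).

Lemma word_of_inj D : injective (@word_of D).
Proof. by move=> i j /val_inj /enum_val_inj. Qed.

Lemma word_ofP D (u : seq Y) : (size u <= D)%N -> exists i : 'I_(fock_dim D), word_of i = u.
Proof. by move=> h; exists (enum_rank (Bseq h)); rewrite /word_of enum_rankK. Qed.

Lemma word_of_vacuum D : word_of (vacuum D) = [::].
Proof. by rewrite /word_of /vacuum enum_rankK. Qed.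

Definition creation y D : 'M[C]_(fock_dim D) :=
  \matrix_(i, j) (word_of i == y :: word_of j)%:R.

Lemma adj_creation y D : adj_mx (creation y D) = \matrix_(i, j) (word_of j == y :: word_of i)%:R.
Proof. by apply/matrixP => i j; rewrite !mxE conjC_nat. Qed.

Lemma opbound_creation y D : opbound (creation y D) 1.
Proof.
apply: opbound_partial_injection => [i j j' /eqP -> /eqP [] | i i' j /eqP h /eqP h'].
  by move/word_of_inj.
by apply: word_of_inj; rewrite h h'.
Qed.

Lemma semicirc_bound y : exists c, fam_bound (fun D => creation y D + adj_mx (creation y D)) c.
Proof.
exists (1 + 1); split=> // D; apply: opboundD => //; last apply: opbound_adj;
  exact: opbound_creation.
Qed.

Definition semicirc y : A := @BoundedFamily R fock_dim vacuum _ (semicirc_bound y).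

Lemma adj_semicirc y : adj (semicirc y) = semicirc y.
Proof. by apply: famE => D; rewrite /= adj_mxD adj_mxK addrC. Qed.

(** Annihilation and creation of [y] on coefficient functions of the untruncated
    Fock space: each value of the result involves two values of [F], so no
    summability is needed. *)
Definition semicirc_op y (F : seq Y -> C) u : C :=
  F (y :: u) + (if u is y' :: u' then if y' == y then F u' else 0 else 0).

(** [a D] agrees with [T] away from the truncation: on words of length at most L,
    using words of length at most L + d only. Carrying the vector and the
    function separately makes the notion stable under products. *)
Definition represents (a : A) (T : (seq Y -> C) -> seq Y -> C) :=
  exists d, forall D (v : 'cV[C]_(fock_dim D)) F L, (L + d <= D)%N ->
    (forall i, (size (word_of i) <= L + d)%N -> v i 0 = F (word_of i)) ->
    forall i, (size (word_of i) <= L)%N -> (a D *m v) i 0 = T F (word_of i).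

Lemma represents_semicirc y : represents (semicirc y) (semicirc_op y).
Proof.
exists 1%N => D v F L LD vF i iL.
transitivity (\sum_j ((word_of j == y :: word_of i)%:R * v j 0
                      + (word_of i == y :: word_of j)%:R * v j 0)).
  by rewrite mxE; apply: eq_bigr => j _; rewrite /= mxE adj_creation !mxE mulrDl addrC.
rewrite addn1 in LD vF; rewrite big_split /=; congr (_ + _).
  have [|j hj] := @word_ofP D (y :: word_of i); first by rewrite /= (leq_trans _ LD).
  rewrite (bigD1 j) //= hj eqxx mul1r big1 ?addr0 => [|k kj].
    by rewrite vF hj.
  by rewrite -hj (inj_eq (@word_of_inj D)) (negPf kj) mul0r.
case E : (word_of i) => [|y' u]; first by rewrite big1 // => j _; rewrite mul0r.
case: eqP => [yy|yy]; last first.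
  by rewrite big1 // => j _; rewrite eqseq_cons; case: eqP => // _; rewrite mul0r.
have uL : (size u < L)%N by rewrite E in iL.
have [|j hj] := @word_ofP D u; first by rewrite ltnW // (ltn_trans uL).
rewrite (bigD1 j) //= hj yy eqxx mul1r big1 ?addr0 => [|k kj].
  by rewrite vF hj // ltnW // ltnW.
rewrite eqseq_cons eqxx /= -hj eq_sym (inj_eq (@word_of_inj D)) (negPf kj) mul0r //.
Qed.

Lemma represents1 : represents 1 id.
Proof. by exists 0%N => D v F L _ vF i iL; rewrite mul1mx vF // addn0. Qed.

Lemma representsD a b T S : represents a T -> represents b S ->
  represents (a + b) (fun F u => T F u + S F u).
Proof.
move=> [d1 h1] [d2 h2]; exists (maxn d1 d2) => D v F L LD vF i iL.
rewrite mulmxDl mxE; congr (_ + _).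
  by apply: (h1 _ _ _ L) => // [|j hj]; [|apply: vF]; lia.
by apply: (h2 _ _ _ L) => // [|j hj]; [|apply: vF]; lia.
Qed.

Lemma representsZ k a T : represents a T -> represents (k *: a) (fun F u => k * T F u).
Proof.
move=> [d h]; exists d => D v F L LD vF i iL.
by rewrite -scalemxAl mxE (h _ _ F L).
Qed.

Lemma representsM a b T S : represents a T -> represents b S ->
  represents (a * b) (fun F => T (S F)).
Proof.
move=> [d1 h1] [d2 h2]; exists (d1 + d2)%N => D v F L LD vF i iL.
rewrite -mulmxA; apply: (h1 _ _ _ L) => // [|j hj]; first lia.
by apply: (h2 _ _ _ (L + d1)%N) => // [|k hk]; [|apply: vF]; lia.
Qed.

Definition vac_fun (u : seq Y) : C := (u == [::])%:R.

(** The vacuum moment reads the empty word, where truncation at D >= d is not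
    felt. *)
Lemma state_represents a T : represents a T ->
  vector_state a = T vac_fun [::].
Proof.
move=> [d h]; apply: (@vector_state_near _ _ _ a _ d) => D dD.
have := h D (delta_mx (vacuum D) 0) vac_fun 0%N dD _ (vacuum D).
rewrite word_of_vacuum -colE mxE; apply=> // i _.
rewrite mxE eqxx andbT /vac_fun; congr ((_ : bool)%:R).
by rewrite -(inj_eq (@word_of_inj D)) word_of_vacuum.
Qed.

Fixpoint prefix_of (p : pred Y) (u : seq Y) : seq Y :=
  if u is y :: u' then if p y then y :: prefix_of p u' else [::] else [::].

Fixpoint rest_of (p : pred Y) (u : seq Y) : seq Y :=
  if u is y :: u' then if p y then rest_of p u' else u else [::].

(** Fock space as the tensor product of the space of words of colour p with that
    of the words that do not begin with p. *)
Definition tensor (p : pred Y) (f G : seq Y -> C) u : C := f (prefix_of p u) * G (rest_of p u).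

Definition acts_on_prefix (p : pred Y) (T : (seq Y -> C) -> seq Y -> C) :=
  forall f G, T (tensor p f G) = tensor p (T f) G.

Definition colored (p : pred Y) : set A :=
  [set a | exists2 T, represents a T & acts_on_prefix p T].

Lemma colored_subalg p : GRing.subalg_closed (mem (colored p)).
Proof.
split.
- by rewrite inE; exists id => //; exact: represents1.
- move=> k a b; rewrite !inE => -[T aT pT] [S bS pS].
  exists (fun F u => k * T F u + S F u).
    exact: (representsD (representsZ k aT) bS).
  move=> f G; apply/funext => u; rewrite pT pS /tensor; ring.
- move=> a b; rewrite !inE => -[T aT pT] [S bS pS].
  exists (fun F => T (S F)); first exact: representsM.
  by move=> f G; rewrite pS pT.
Qed.

Lemma colored_semicirc (p : pred Y) y : p y -> colored p (semicirc y).
Proof.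
move=> py; exists (semicirc_op y); first exact: represents_semicirc.
move=> f G; apply/funext => u; rewrite /semicirc_op /tensor /= py mulrDl; congr (_ + _).
case: u => [|y' u] /=; first by rewrite mul0r.
case: (eqVneq y' y) => [->|yy]; first by rewrite py eqxx.
by case: ifP => _; rewrite ?(negPf yy) mul0r.
Qed.

Lemma colored_lin p a b (k l : C) : colored p a -> colored p b ->
  colored p (k *: (a + l *: b)).
Proof.
move=> [T aT pT] [S bS pS]; exists (fun F u => k * (T F u + l * S F u)).
  exact: (representsZ k (representsD aT (representsZ l bS))).
by move=> f G; apply/funext => u; rewrite pT pS /tensor; ring.
Qed.

(** Applying the factors from the right, the vector always consists of words that
    begin with the colour of the last factor used: the next factor, of another
    colour, acts on the empty prefix, and the vacuum component it could leave is
    its own vanishing moment. *)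
Lemma free_colored (I : Type) (p : I -> pred Y) (S : I -> set A) :
  (forall i i' y, p i y -> p i' y -> i = i') ->
  (forall i, S i `<=` colored (p i)) ->
  free_sets (vector_state : {scalar A}) S.
Proof.
move=> disj SB m i x alt xS x0.
have {xS} xB k : colored (p (i k)) (x k).
  by apply: (xS k); split; [exact: colored_subalg | exact: SB].
suff [T [hT T0]] : exists T, represents (\prod_k x k) T /\
    forall u, (if u is y :: _ then ~~ p (i ord0) y else true) -> T vac_fun u = 0.
  by rewrite [LHS](state_represents hT) T0.
have step (a : A) (q : pred Y) T V : represents a T -> acts_on_prefix q T ->
    vector_state a = 0 -> V = tensor q vac_fun V ->
    forall u, (if u is y :: _ then ~~ q y else true) -> T V u = 0.
  move=> aT qT a0 VE u hu; rewrite VE qT /tensor.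
  have -> : prefix_of q u = [::] by case: u hu => //= y u /negPf ->.
  by rewrite -(state_represents aT) a0 mul0r.
elim: m i x alt x0 xB => [|m IH] i x alt x0 xB.
  have [T xT pT] := xB ord0; exists T; rewrite big_ord_recl big_ord0 mulr1; split=> //.
  apply: (step _ _ _ _ xT pT (x0 ord0)); apply/funext => u; rewrite /tensor.
  by case: u => [|y u] /=; rewrite /vac_fun /= ?mulr1 //; case: (p _ y); rewrite /= ?mul0r ?mulr0.
have [||| T' [hT' T'0]] := IH (fun k => i (lift ord0 k)) (fun k => x (lift ord0 k)).
- by move=> k l kl; apply: alt; rewrite /= /bump /= kl.
- by move=> k; exact: x0.
- by move=> k; exact: xB.
have [T xT pT] := xB ord0; exists (fun F => T (T' F)); split.
  by rewrite big_ord_recl; exact: representsM.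
apply: (step _ _ _ _ xT pT (x0 ord0)); apply/funext => u; rewrite /tensor.
case: u => [|y u] /=; first by rewrite /vac_fun eqxx mul1r.
case: ifP => py; last by rewrite /vac_fun eqxx mul1r.
rewrite /vac_fun /= mul0r T'0 //.
apply/negP => py'; apply: (alt ord0 (lift ord0 ord0)) => //.
exact: disj py py'.
Qed.

(** Only powers of [y] are reached, along walks of the length of the word. *)
Lemma semicirc_iter y k u : iter k (semicirc_op y) vac_fun u =
  (if u == nseq (size u) y then ballot k (size u) else 0)%:R.
Proof.
elim: k u => [|k IH] u.
  by case: u => [|y' u] //=; rewrite /vac_fun /=; case: ifP.
rewrite iterS {1}/semicirc_op !IH /= eqseq_cons eqxx /=.
case: u => [|y' u] /=; first by rewrite addr0 addn0.
rewrite IH eqseq_cons; case: (y' == y) => /=; last by rewrite addr0.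
by case: ifP => _; rewrite ?addr0 // -natrD.
Qed.

Lemma semicircular_semicirc y : semicircular (vector_state : {scalar A}) (semicirc y).
Proof.
have hX k : represents (semicirc y ^+ k) (iter k (semicirc_op y)).
  elim: k => [|k IH]; first exact: represents1.
  by rewrite exprS; exact: representsM (represents_semicirc y) IH.
have mom k : (vector_state : {scalar A}) (semicirc y ^+ k) = (ballot k 0)%:R.
  by rewrite [LHS](state_represents (hX k)) semicirc_iter.
split; first exact: adj_semicirc.
- by move=> k ok; rewrite mom ballot_odd //= ok.
- move=> k; rewrite mom; apply: (@mulIf _ k.+1%:R); first by rewrite pnatr_eq0.
  by rewrite divfK ?pnatr_eq0 // -natrM ballot_catalan.
Qed.

End Fock.

(** * Circular elements *)

Section CircularFamily.
Variables (R : realType) (m : nat).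
Local Notation C := R[i].
Local Notation letter := ('I_m * bool)%type.
Local Notation A := (@bounded_family R (fock_dim letter) (@vacuum letter)).
Local Notation phi := (vector_state : {scalar A}).
Local Notation a := ((sqrtC 2)^-1 : C).

Lemma conj_inv_sqrt2 : Num.conj a = a.
Proof. by apply: geC0_conj; rewrite invr_ge0 sqrtC_ge0. Qed.

Lemma mul_inv_sqrt2 : a * a = 2^-1.
Proof. by rewrite -expr2 exprVn sqrtCK. Qed.

Definition unit_of (t : bool) : C := if t then - 'i%C else 'i%C.

Lemma unit_mul s t : unit_of s * unit_of t = if s == t then -1 else 1.
Proof.
have i2 : 'i%C * 'i%C = -1 :> C.
  by apply/eqP; rewrite eq_complex /= !mul0r !mulr0 !mulr1 sub0r addr0 oppr0 !eqxx.
by case: s t => [] [] /=; rewrite /unit_of ?(mulrN, mulNr) i2 ?opprK.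
Qed.

Definition circ (l : letter) : A :=
  a *: (semicirc R (l.1, false) + unit_of l.2 *: semicirc R (l.1, true)).

Lemma adj_circ j t : adj (circ (j, t)) = circ (j, ~~ t).
Proof.
rewrite /circ Defs.adjZ Defs.adjD Defs.adjZ !adj_semicirc conj_inv_sqrt2; congr (_ *: (_ + _ *: _)).
by case: t; apply/eqP; rewrite eq_complex /= ?oppr0 ?opprK !eqxx.
Qed.

Lemma circular_circ j : circular phi (circ (j, false)).
Proof.
exists (semicirc R (j, false)), (semicirc R (j, true)); split.
- exact: semicircular_semicirc.
- exact: semicircular_semicirc.
- apply: (@free_colored _ _ _ (fun t y => y == (j, t))).
    by move=> t t' y /eqP -> /eqP [].
  by move=> [] x /= ->; apply: colored_semicirc.
- by [].
Qed.

Lemma free_circ : free_sets phi (fun j => [set circ (j, false); adj (circ (j, false))]).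
Proof.
apply: (@free_colored _ _ _ (fun j y => y.1 == j)).
  by move=> j j' y /eqP <- /eqP.
have H j t : colored (fun y => y.1 == j) (circ (j, t)).
  by apply: colored_lin; apply: colored_semicirc.
by move=> j x [->|->]; rewrite ?adj_circ; exact: H.
Qed.

Definition circ_op (l : letter) (F : seq letter -> C) u : C :=
  a * (semicirc_op (l.1, false) F u + unit_of l.2 * semicirc_op (l.1, true) F u).

Lemma represents_circ l : represents (circ l) (circ_op l).
Proof.
apply: representsZ; apply: representsD; first exact: represents_semicirc.
by apply: representsZ; exact: represents_semicirc.
Qed.

(** Evaluation of a function of words against the tensor product of the vectors
    (e_(j,false) + unit_of t e_(j,true)) / sqrt 2, without conjugation, so that a
    stack of circular letters acts as a linear form on Fock space. *)
Fixpoint stack_eval (s : seq letter) (F : seq letter -> C) : C :=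
  if s is l :: s' then
    a * (stack_eval s' (fun u => F ((l.1, false) :: u)) +
         unit_of l.2 * stack_eval s' (fun u => F ((l.1, true) :: u)))
  else F [::].

Lemma stack_evalZD s k F G :
  stack_eval s (fun u => k * F u + G u) = k * stack_eval s F + stack_eval s G.
Proof. by elim: s F G => [|l s IH] F G //=; rewrite !IH; ring. Qed.

Lemma stack_eval0 s : stack_eval s (fun=> 0) = 0.
Proof. by elim: s => [|l s IH] //=; rewrite !IH !mulr0 addr0 mulr0. Qed.

Definition create (y : letter) (F : seq letter -> C) (u : seq letter) : C :=
  if u is y' :: u' then if y' == y then F u' else 0 else 0.

Lemma stack_eval_create s j t F : stack_eval s (create (j, t) F) =
  if s is l :: s' then
    if l.1 == j then a * (if t then unit_of l.2 else 1) * stack_eval s' F else 0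
  else 0.
Proof.
case: s => [|[j' t'] s] //=; rewrite !xpair_eqE.
case: (j' == j) => /=; last by rewrite stack_eval0 mulr0 addr0 mulr0.
by case: t => /=; rewrite ?stack_eval0 ?mulr0 ?add0r ?addr0 ?mul1r ?mulr1 ?mulrA.
Qed.

(** The creation part of [circ] l meets the vector on top of the stack, and the
    bilinear product of the vectors of l and l' is 1 if they are adjoint to each
    other and 0 otherwise. *)
Lemma stack_eval_circ s l F : stack_eval s (circ_op l F) =
  stack_eval (l :: s) F +
  (if s is y :: s' then if y == flip l then stack_eval s' F else 0 else 0).
Proof.
have E y : semicirc_op y F = fun u => 1 * F (y :: u) + create y F u.
  by apply/funext => u; rewrite mul1r.
have -> : circ_op l F = fun u => a * (1 * semicirc_op (l.1, false) F u +
    (unit_of l.2 * semicirc_op (l.1, true) F u + 0)) + 0.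
  by apply/funext => u; rewrite /circ_op mul1r !addr0.
rewrite !stack_evalZD !stack_eval0 !E !stack_evalZD !stack_eval_create /=.
case: s => [|[j' t'] s] /=; first by ring.
case: l => j t /=; rewrite /flip xpair_eqE /=.
case: (j' == j) => /=; last by ring.
have h : a * (a * stack_eval s F * (1 + unit_of t * unit_of t')) =
    if t' == ~~ t then stack_eval s F else 0.
  rewrite unit_mul mulrA mulrA mul_inv_sqrt2; case: t t' => [] [] /=; rewrite ?addrN ?mulr0 //;
  by field.
rewrite -h; ring.
Qed.

Lemma stack_eval_vac s : stack_eval s (@vac_fun R letter) = (s == [::])%:R.
Proof.
by case: s => [|l s] //=; rewrite (_ : (fun u => _) = fun=> 0) // !stack_eval0 !mulr0 addr0 mulr0.
Qed.

Lemma circ_word (w : seq letter) : exists2 T, represents (\prod_(l <- w) circ l) T &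
  forall s, stack_eval s (T (@vac_fun R letter)) = (stack_runs (@flip _) w s)%:R.
Proof.
elim: w => [|l w [T wT hT]].
  by exists id; [rewrite big_nil; exact: represents1 | move=> s; rewrite stack_eval_vac].
exists (fun F => circ_op l (T F)).
  by rewrite big_cons; exact: representsM (represents_circ l) wT.
move=> s; rewrite stack_eval_circ !hT /= natrD; congr (_ + _).
by case: s => // y s; case: ifP => // _; rewrite hT.
Qed.

Theorem circ_moment (w : seq letter) :
  phi (\prod_(l <- w) circ l) = (stack_runs (@flip _) w [::])%:R.
Proof.
by have [T wT hT] := circ_word w; rewrite [LHS](state_represents wT) -(hT [::]).
Qed.

End CircularFamily.

(** * Convergence in moments *)

Section WordLimit.
Variables (R : realType) (L : eqType) (bar : L -> L) (G : nat -> finGroupType).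
Local Notation C := R[i].

Lemma cvg_group_runs (w : seq L) :
  #|commuting_pairs (G N)|%:R / #|G N|%:R ^+ 2 @[N --> \oo] --> (0 : R) ->
  group_runs bar C w [::] (1%g : G N) @[N --> \oo]
    --> ((stack_runs bar w [::])%:R : C^o).
Proof.
move=> h; apply/(@cvgrPdist_le C C^o) => eps eps0.
have [er Eeps] : exists er : R, eps = er%:C.
  by case: eps eps0 => x y; rewrite ltcE => /andP[/eqP /= -> _]; exists x.
have er0 : 0 < er by move: eps0; rewrite Eeps ltcR.
set r : R := (runs bar w [::])%:R.
(* r + 1 instead of r, which may vanish *)
have d0 : 0 < er / (r + 1) by rewrite divr_gt0 // ltr_wpDl.
move/(@cvgrPdist_le R R^o): h => /(_ _ d0).
apply: filterS => N /=; rewrite sub0r normrN ger0_norm ?divr_ge0 ?exprn_ge0 // => hN.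
have /andP[h1 h2] := group_runs_stack_runs bar (G N) C w.
rewrite distrC ger0_norm //; apply: le_trans h2 _.
rewrite Eeps; have -> : #|commuting_pairs (G N)|%:R / #|G N|%:R ^+ 2 * (runs bar w [::])%:R =
    (#|commuting_pairs (G N)|%:R / #|G N|%:R ^+ 2 * r)%:C :> C.
  by rewrite !rmorphM fmorphV rmorphXn !rmorph_nat.
rewrite lecR; apply: le_trans (ler_wpM2r (ler0n _ _) hN) _.
rewrite mulrAC ler_pdivrMr ?ltr_wpDl //; apply: ler_wpM2l; first exact: ltW.
by rewrite lerDl.
Qed.

End WordLimit.

Lemma cvg_linear_combination (K : numFieldType) (T : Type) (s : seq T) (a : T -> K)
    (f : T -> nat -> K) (l : T -> K) :
  (forall w, f w N @[N --> \oo] --> (l w : K^o)) ->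
  \sum_(w <- s) a w * f w N @[N --> \oo] --> (\sum_(w <- s) a w * l w : K^o).
Proof.
move=> h; elim: s => [|w s IH].
  by rewrite big_nil; under eq_fun do rewrite big_nil; exact: cvg_cst.
rewrite big_cons; under eq_fun do rewrite big_cons.
by apply: (@cvgD K K^o) => //; exact: cvgMr.
Qed.

Theorem proposition5p1 (R : realType) (G : nat -> finGroupType)
  (G_infty : #|G N|%N @[N --> \oo] --> \oo)
  (mu_infty : cvg_weakly (fun N => mu_tilde R (G N)) (dirac_infty R))
  (m : nat) (m_gt0 : (0 < m)%N)
  (d : nat -> measure_display) (T : forall N, measurableType (d N))
  (P : forall N, probability (T N) R)
  (X : forall N, 'I_m -> G N -> T N -> R[i])
  (X_gaussian : forall N j g, std_complex_gaussian (P N) (X N j g))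
  (X_indep_entries : forall N j,
     mutually_independent (P N) (fun g => sigma_crv (fun _ : unit => X N j g)))
  (X_indep_families : forall N,
     mutually_independent (P N) (fun j => sigma_crv (X N j))) :
  exists (A : cstarAlgType R) (phi : {scalar A}) (c : 'I_m -> A),
    [/\ is_state phi,
        forall j, circular phi (c j),
        free_sets phi (fun j => [set c j; adj (c j)])
      & cvg_in_moments
          (fun N (Q : ncpoly R[i] ('I_m * bool)%type) =>
             exp_ntrace (P N) (fun w =>
               nc_eval_mx
                 (fun jt => scaled_conv_mx (fun g => X N jt.1 g w) jt.2) Q))
          (fun Q => phi (nc_eval
             (fun jt => if jt.2 then adj (c jt.1) else c jt.1) Q))].
Proof.
set letter := ('I_m * bool)%type.
exists (@bounded_family R (fock_dim letter) (@vacuum letter)), (vector_state : {scalar _}),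
  (fun j => circ R (j, false)).
split; [exact: vector_state_is_state | exact: circular_circ | exact: free_circ | move=> Q].
have -> : (vector_state : {scalar _}) (nc_eval (fun jt : letter =>
    if jt.2 then adj (circ R (jt.1, false)) else circ R (jt.1, false)) Q) =
    \sum_(w <- finsupp Q) Q w * (stack_runs (@flip _) w [::])%:R.
  rewrite /nc_eval raddf_sum; apply: eq_bigr => w _; rewrite -circ_moment [LHS]scalarZ /=.
  congr (_ * vector_state _); apply: eq_bigr => -[j t] _.
  by rewrite adj_circ; case: t.
have E N : exp_ntrace (P N) (fun w => nc_eval_mx
      (fun jt : letter => scaled_conv_mx (fun g => X N jt.1 g w) jt.2) Q) =
    \sum_(w <- finsupp Q) Q w * group_runs (@flip _) R[i] w [::] (1%g : G N).
  have ew w := exp_ntrace_word (X_gaussian N) (X_indep_entries N) (X_indep_families N) w.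
  rewrite /exp_ntrace /nc_eval_mx.
  under [X in cexpectation _ X]eq_fun.
    by move=> o; rewrite raddf_sum; under eq_bigr do rewrite /= mxtraceZ; over.
  rewrite cexpectation_sum; last by move=> w _; apply: cintegrableZ; case: (ew w).
  rewrite mulr_sumr; apply: eq_bigr => w _.
  case: (ew w) => iw <-; rewrite cexpectationZ //; exact: mulrCA.
under eq_fun do rewrite E.
apply: cvg_linear_combination => w; apply: cvg_group_runs.
exact: cvg_commuting_probability.
Qed.
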